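(* Let $\mathbf f$ be a projection in $\mathcal C(I)$. Then there are a partition $x_1<\dots<x_n$ of $X$ with closed subintervals $X_0,\dots,X_n$ and a tuple $(f_0,\dots,f_n)$ representing $\mathbf f$ over this partition such that each $f_i$ is projection valued, i.e. $f_i(x)$ is a projection for every $x\in X_i$.
   Context: $H$ is a separable infinite-dimensional complex Hilbert space, $B(H)$ the bounded operators and $K$ the compact operators on $H$. $X$ is one of $[0,1]$, $[0,\infty)$, $(-\infty,\infty)$, $\mathbb T=[0,1]/\{0,1\}$. $I=C(X)\otimes K$ is the $C^*$-algebra of norm continuous functions $X\to K$ (vanishing in norm at the infinite ends of $X$, if any). Its multiplier algebra is $M(I)=C_b(X,B(H))$, the bounded functions $X\to B(H)$ continuous for the double-strong (i.e. strong-$*$) topology. $\mathcal C(I)=M(I)/I$ is the corona algebra. Representing tuples: take points $x_1<\dots<x_n$ in the interior of $X$ (in $(0,1)$ if $X=\mathbb T$), dividing $X$ (or $[0,1]$ if $X=\mathbb T$) into closed subintervals $X_0,X_1,\dots,X_n$ in order, with $x_i$ the common end point of $X_{i-1}$ and $X_i$. If $X=\mathbb T$, $x_0$ is the point $0=1$, and $f_0(x_0)$ means the value of $f_0$ at $0$, $f_n(x_0)$ the value of $f_n$ at $1$. A tuple $(f_0,\dots,f_n)$ with $f_i\in C_b(X_i,B(H))$ (strong-$*$ continuous, bounded), $f_i(x_i)-f_{i-1}(x_i)\in K$ for $i=1,\dots,n$, and $f_0(x_0)-f_n(x_0)\in K$ if $X=\mathbb T$, represents the element of $\mathcal C(I)$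 equal to the coset of all $f\in M(I)$ such that, for every $i$, $f|_{X_i}-f_i$ is norm continuous with values in $K$ and vanishes in norm at any infinite end point of $X_i$. *)

(* Defs.v *)
From HB Require Import structures.
From mathcomp Require Import all_boot all_order all_algebra sesquilinear.
From mathcomp Require Import complex.
From mathcomp Require Import all_classical all_reals all_analysis.

Set Implicit Arguments.
Unset Strict Implicit.
Unset Printing Implicit Defensive.

Import Order.TTheory GRing.Theory Num.Theory.
Import numFieldNormedType.Exports.

Local Open Scope classical_set_scope.
Local Open Scope ring_scope.
Local Open Scope complex_scope.

(* The norm of a [normedModType] over [R[i]] takes its values in [R[i]]. The
   inner product is linear in its first argument, semilinear in the second. *)
HB.mixin Record CompleteNormedModule_isHilbert (R : realType) (H : Type)
    & CompleteNormedModule R[i] H := {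
  inner : {dot H for Num.conj};
  innerE : forall v : H, inner v v = `|v| ^+ 2 }.

#[short(type="hilbertType")]
HB.structure Definition Hilbert (R : realType) :=
  { H of CompleteNormedModule R[i] H & CompleteNormedModule_isHilbert R H }.

Definition separable (T : topologicalType) :=
  exists D : set T, countable D /\ dense D.

Definition infinite_dimensional (K : fieldType) (V : lmodType K) :=
  ~ exists s : seq V, forall v : V,
      exists c : nat -> K, v = \sum_(i < size s) c i *: s`_i.

Section Operators.
Variables (R : realType) (H : hilbertType R).
Implicit Types T S : H -> H.

Definition bounded_op T :=
  linear T /\ exists M : R, forall v, `|T v| <= M%:C * `|v|.

Definition compact_op T :=
  bounded_op T /\ precompact (T @` [set v | `|v| <= 1]).

(* Only meaningful when [T] is bounded. *)
Definition opnorm T : R :=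
  sup [set complex.Re `|T v| | v in [set v | `|v| <= 1]].

(* For bounded [T] the adjoint exists and is unique, by the Riesz
   representation theorem; otherwise the value is arbitrary. *)
Definition adj T : H -> H :=
  get [set S : H -> H | forall u v, inner (T u) v = inner u (S v)].

Definition projection_op T := [/\ bounded_op T, T \o T = T & adj T = T].

End Operators.

(* [Circle] is [0, 1] with its end points identified, so that a function on it
   is a function on [0, 1] taking the same value at 0 and 1. *)
Variant base := UnitInterval | HalfLine | Line | Circle.

Definition carrier (R : realType) (X : base) : set R :=
  match X with
  | UnitInterval | Circle => `[0, 1]
  | HalfLine => `[0, +oo[
  | Line => setT
  end.
Arguments carrier : clear implicits.

(* Operator-valued functions are total functions [R -> H -> H]; everything
   below constrains them only on the relevant subset [D] of the real line. *)
Section OperatorFunctions.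
Variables (R : realType) (H : hilbertType R).
Implicit Types (D : set R) (X : base) (f g : R -> H -> H).

Definition norm_continuous_on D g :=
  forall x, D x -> opnorm (g y - g x) @[y --> within D (nbhs x)] --> (0 : R).

Definition strong_star_continuous_on D f :=
  forall v : H, {within D, continuous (fun x => f x v)} /\
                {within D, continuous (fun x => adj (f x) v)}.

(* If [D] is bounded above (below), the filter [within D +oo] (resp.
   [within D -oo]) is improper and the corresponding limit holds trivially:
   there is a condition only at the infinite ends of [D]. *)
Definition vanishes_at_infinite_ends D g :=
  opnorm (g x) @[x --> within D (pinfty_nbhs R)] --> (0 : R) /\
  opnorm (g x) @[x --> within D (ninfty_nbhs R)] --> (0 : R).

Definition C0K D g :=
  [/\ forall x, D x -> compact_op (g x),
      norm_continuous_on D g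
    & vanishes_at_infinite_ends D g].

Definition CbB D f :=
  [/\ forall x, D x -> bounded_op (f x),
      exists M : R, forall x, D x -> opnorm (f x) <= M
    & strong_star_continuous_on D f].

Definition descends X f := X = Circle -> f 0 = f 1.

(* I = C(X) (x) K and its multiplier algebra M(I) = C_b(X, B(H)). *)
Definition idealI X g := C0K (carrier R X) g /\ descends X g.

Definition multI X f := CbB (carrier R X) f /\ descends X f.

(* Elements of the corona algebra M(I) / I are cosets, with the operations
   (f + I)(g + I) = f g + I and (f + I)^* = f^* + I. *)
Definition coset X f : set (R -> H -> H) :=
  [set g | multI X g /\ idealI X (g - f)].

Definition in_corona X (A : set (R -> H -> H)) :=
  exists2 f, multI X f & A = coset X f.

Definition corona_mul X (A B : set (R -> H -> H)) : set (R -> H -> H) :=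
  [set h | exists f g, [/\ A f, B g & coset X (fun x => f x \o g x) h]].

Definition corona_star X (A : set (R -> H -> H)) : set (R -> H -> H) :=
  [set h | exists2 f, A f & coset X (fun x => adj (f x)) h].

Definition corona_projection X (A : set (R -> H -> H)) :=
  [/\ in_corona X A, corona_mul X A A = A & corona_star X A = A].

(* The division points are [x 1 < ... < x n]; other values of [x] are unused,
   as are the entries of a tuple [f 0, ..., f n] of index greater than [n]. *)
Definition partition_points X (n : nat) (x : nat -> R) :=
  [/\ (0 < n)%N,
      forall i, (0 < i <= n)%N -> interior (carrier R X) (x i)
    & forall i, (0 < i < n)%N -> x i < x i.+1].

Definition piece X (n : nat) (x : nat -> R) (i : nat) : set R :=
  [set t | [/\ carrier R X t, (0 < i)%N -> x i <= t
             & (i < n)%N -> t <= x i.+1]].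

Definition compatible_tuple X n (x : nat -> R) (f : nat -> R -> H -> H) :=
  [/\ forall i, (i <= n)%N -> CbB (piece X n x i) (f i),
      forall i, (0 < i <= n)%N -> compact_op (f i (x i) - f i.-1 (x i))
    & X = Circle -> compact_op (f 0%N 0 - f n 1)].

Definition represents X n (x : nat -> R) (f : nat -> R -> H -> H)
    (A : set (R -> H -> H)) :=
  compatible_tuple X n x f /\
  A = [set g | multI X g /\
               forall i, (i <= n)%N -> C0K (piece X n x i) (g - f i)].

End OperatorFunctions.

(* Main.v *)
(* A projection in the corona algebra has a self-adjoint lift [f], and
   [f^2 - f], hence [s^2 - 1] with [s = 2 f - 1], lies in [C(X) (x) K].
   At a point [x0] the compact self-adjoint operator [s(x0)^2 - 1] has only
   finitely many eigenvalues of modulus greater than 1/4, so some finite-rank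
   self-adjoint [K] makes [(s(x0) + K)^2 - 1] small; as this expression is norm
   continuous in [x], it stays small near [x0]. The Newton-Schulz iteration
   [y -> y (3 - y^2) / 2] started at [s + K] then converges uniformly to a
   symmetry [y] ([y = y^*], [y^2 = 1]), each step changing [y] by an element of
   [C(.) (x) K], so that [(1 + y) / 2] is a projection-valued function congruent
   to [f] near [x0]. Near an infinite end of [X] one may take [K = 0]. A Lebesgue
   number argument yields the partition. *)

Require Import Defs.
From mathcomp Require Import all_boot all_order all_algebra sesquilinear complex ring lra.
From mathcomp Require Import all_classical all_reals all_analysis.

Set Implicit Arguments.
Unset Strict Implicit.
Unset Printing Implicit Defensive.

Import Order.TTheory GRing.Theory Num.Theory.
Import numFieldNormedType.Exports.

Local Open Scope classical_set_scope.
Local Open Scope ring_scope.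
Local Open Scope complex_scope.

(** * Real inner product and norm *)

Section RealHilbert.
Variables (R : realType) (H : hilbertType R).
Implicit Types (u v w : H) (t : R) (a : R[i]).

(** The lift is continuous only for the strong-* topology, so [f] and [s + K] cannot be compared in
    norm at nearby points; only [s^2 - 1] and products with a norm continuous compact factor can.
    Everything done to the lift must therefore stay within strongly continuous families and change
    them only by elements of [C0K]. A polynomial iteration does so at every step: each correction is
    a strongly continuous family times the defect [1 - y^2], which lies in [C0K]. The only spectral
    input is the existence of eigenvectors of compact self-adjoint operators, produced one at a
    time. The perturbation [K] depends on the base point, and a nonzero constant family lies in
    [C0K] only over a bounded set. Projections built from different [K] need not agree where they
    meet, whence a tuple with compact jumps instead of one function. Constants: the iteration starts
    from a defect of norm at most 1/2, made up of 1/4 at the base point and 1/4 for the variation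
    around it; near infinity the defect is [-4 (f^2 - f)], so 1/8 is asked of [f^2 - f]. *)

Definition nrm v : R := complex.Re `|v|.
(** Taking real parts, as in [nrm], moves all estimates to the ordered field [R], where [lra] and
    [nra] apply; [inner_ip] recovers the full inner product. *)
Definition ip u v : R := complex.Re (inner u v).

Lemma normE v : `|v| = (nrm v)%:C.
Proof. by rewrite /nrm RRe_real // ger0_real. Qed.

Lemma nrm_ge0 v : 0 <= nrm v.
Proof. by rewrite -ler0c -normE. Qed.

Lemma nrm0 : nrm 0 = 0.
Proof. by rewrite /nrm normr0. Qed.

Lemma nrm_eq0 v : nrm v = 0 -> v = 0.
Proof. by move=> v0; apply/eqP; rewrite -normr_eq0 normE v0. Qed.

Lemma nrmZ t v : nrm (t%:C *: v) = `|t| * nrm v.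
Proof.
apply: complexI; rewrite -normE normrZ rmorphM /= normE; congr (_ * _).
by rewrite normc_def /= expr0n addr0 sqrtr_sqr.
Qed.

Lemma nrmN v : nrm (- v) = nrm v.
Proof. by rewrite /nrm normrN. Qed.

Lemma nrm_distC u v : nrm (u - v) = nrm (v - u).
Proof. by rewrite /nrm distrC. Qed.

Lemma ler_nrmD u v : nrm (u + v) <= nrm u + nrm v.
Proof. by rewrite -lecR rmorphD /= -!normE ler_normD. Qed.

Lemma ler_nrmB u v : nrm (u - v) <= nrm u + nrm v.
Proof. by rewrite (le_trans (ler_nrmD _ _)) // nrmN. Qed.

Lemma innerDl u v w : inner (u + v) w = inner u w + inner v w.
Proof. exact: linearDl. Qed.

Lemma innerZl a u w : inner (a *: u) w = a * inner u w.
Proof. exact: linearZl_LR. Qed.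

Lemma ipDl u v w : ip (u + v) w = ip u w + ip v w.
Proof. by rewrite /ip innerDl; case: (inner u w) => a b; case: (inner v w). Qed.

Lemma ipC u v : ip u v = ip v u.
Proof. by rewrite /ip hermC /= expr0 mul1r; case: (inner v u). Qed.

Lemma ipZl t u w : ip (t%:C *: u) w = t * ip u w.
Proof.
by rewrite /ip innerZl; case: (inner u w) => c d /=; rewrite mul0r subr0.
Qed.

Lemma ipDr u v w : ip w (u + v) = ip w u + ip w v.
Proof. by rewrite !(ipC w) ipDl. Qed.

Lemma ipZr t u w : ip w (t%:C *: u) = t * ip w u.
Proof. by rewrite !(ipC w) ipZl. Qed.

Lemma ipNl u w : ip (- u) w = - ip u w.
Proof.
by rewrite -[RHS]mulN1r -ipZl rmorphN1 scaleN1r.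
Qed.

Lemma ipNr u w : ip w (- u) = - ip w u.
Proof. by rewrite !(ipC w) ipNl. Qed.

Lemma ip0l w : ip 0 w = 0.
Proof. by rewrite -(mul0r (ip 0 w)) -ipZl scaler0. Qed.

Lemma ip0r w : ip w 0 = 0.
Proof. by rewrite ipC ip0l. Qed.

Definition ipE := (ipDl, ipDr, ipZl, ipZr, ipNl, ipNr, ip0l, ip0r).

Lemma ipvv v : ip v v = nrm v ^+ 2.
Proof. by rewrite /ip innerE normE -rmorphXn. Qed.

Lemma ip_inj u v : (forall w, ip u w = ip v w) -> u = v.
Proof.
move=> uv; apply/eqP; rewrite -subr_eq0; apply/eqP/nrm_eq0/eqP.
by rewrite -sqrf_eq0 -ipvv ipDl ipNl uv subrr.
Qed.

(** Multiplying [u] by ['i] turns the imaginary part into a real part up to sign. This upgrades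
    identities for [ip] to identities for [inner]. *)
Lemma inner_ip u v : inner u v = ip u v +i* - ip ('i *: u) v.
Proof.
rewrite /ip innerZl; case: (inner u v) => c d /=.
by rewrite mul0r mul1r sub0r opprK.
Qed.

(** Cauchy-Schwarz: the squared norm of [|v| u - |u| v] equals [2 |u| |v| (|u| |v| - ip u v)] and is
    nonnegative. *)
Lemma ip_le u v : ip u v <= nrm u * nrm v.
Proof.
have [v0|v0] := eqVneq (nrm v) 0.
  by rewrite v0 (nrm_eq0 v0) ip0r mulr0.
have [u0|u0] := eqVneq (nrm u) 0.
  by rewrite u0 (nrm_eq0 u0) ip0l mul0r.
have up : 0 < nrm u by rewrite lt_def u0 nrm_ge0.
have vp : 0 < nrm v by rewrite lt_def v0 nrm_ge0.
have := sqr_ge0 (nrm ((nrm v)%:C *: u - (nrm u)%:C *: v)).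
rewrite -ipvv !ipE !ipvv (ipC v u) => h.
have : 0 <= (nrm u * nrm v) * (nrm u * nrm v - ip u v) by nra.
by rewrite pmulr_rge0 ?mulr_gt0// subr_ge0.
Qed.

Lemma cvg_nrmP (I : Type) (F : set_system I) {FF : Filter F} (g : I -> H) (l : H) :
  g i @[i --> F] --> l <->
  (forall e : R, 0 < e -> \forall i \near F, nrm (g i - l) <= e).
Proof.
split=> [/cvgrPdist_le gl e e0|gl].
  have := gl e%:C; rewrite ltcR => /(_ e0); apply: filterS => i.
  by rewrite normE lecR nrm_distC.
(* A positive element of [R[i]] has zero imaginary part, so real radii suffice. *)
apply/cvgrPdist_le => e; case: e => e d; rewrite ltcE /= => /andP[/eqP -> e0].
by apply: filterS (gl _ e0) => i; rewrite nrm_distC normE lecR.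
Qed.

Lemma nrm_complete (g : nat -> H) :
  (forall e : R, 0 < e -> exists N, forall m n, (N <= m)%N -> (N <= n)%N ->
     nrm (g m - g n) <= e) ->
  exists l : H, g n @[n --> \oo] --> l.
Proof.
move=> cg; apply/cvg_ex; apply/cauchy_cvgP/cauchy_exP => e.
case: e => e d; rewrite ltcE /= => /andP[/eqP -> e0].
have [N gN] := cg (e / 2) (divr_gt0 e0 (ltr0Sn _ 1)).
exists (g N); exists N => // n /= Nn; rewrite -ball_normE /=.
rewrite normE ltcR (le_lt_trans (gN _ _ _ _)) //.
by rewrite ltr_pdivrMr // ltr_pMr // ltr1n.
Qed.

(* The Riesz vector minimizes [|v|^2 - 2 phi v]; by the parallelogram law every
   minimizing sequence is Cauchy. *)
Lemma riesz (phi : H -> R) (M : R) :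
  (forall u v, phi (u + v) = phi u + phi v) ->
  (forall t u, phi (t%:C *: u) = t * phi u) ->
  (forall v, phi v <= M * nrm v) ->
  exists w, forall v, phi v = ip v w.
Proof.
move=> phiD phiZ phiM.
pose J v := nrm v ^+ 2 - 2 * phi v.
have JM v : - M ^+ 2 <= J v.
  by have := phiM v; have := sqr_ge0 (nrm v - M); rewrite /J; nra.
pose E := range J.
have hE : has_inf E.
  split; first by exists (J 0), 0.
  by exists (- M ^+ 2) => _ [v _ <-].
have infJ v : inf E <= J v by apply: ge_inf; [exact: hE.2|exists v].
(* The infimum is tested at the midpoint [m] of [u] and [v]: [J u + J v - 2 J m] is
   [|u - v|^2 / 2]. *)
have par u v e : J u <= inf E + e -> J v <= inf E + e ->
    nrm (u - v) ^+ 2 <= 4 * e.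
  move=> ue ve; have := infJ (2^-1%:C *: (u + v)).
  move: ue ve; rewrite /J phiZ phiD -!ipvv !ipE (ipC v u); lra.
have /choice[g gP] : forall n : nat, exists v, J v <= inf E + n.+1%:R^-1.
  move=> n; have n0 : 0 < n.+1%:R^-1 :> R by rewrite invr_gt0.
  by have [_ [v _ <-] /ltW] := inf_adherent n0 hE; exists v.
have small (e : R) : 0 < e -> exists N, forall n, (N <= n)%N -> n.+1%:R^-1 <= e.
  move=> e0; exists (Num.truncn e^-1) => n Nn.
  rewrite invf_ple ?posrE // ltW // (lt_le_trans (truncnS_gt _)) //.
  by rewrite ler_nat.
have [e e0|w gw] := nrm_complete (g := g).
  have [|N NP] := small (e ^+ 2 / 4); first by rewrite divr_gt0 ?exprn_gt0.
  exists N => m n Nm Nn; rewrite -(@ler_pXn2r _ 2) ?nnegrE ?nrm_ge0 ?(ltW e0) //.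
  have -> : e ^+ 2 = 4 * (e ^+ 2 / 4) by field.
  apply: par; first by rewrite (le_trans (gP m)) // lerD2l NP.
  by rewrite (le_trans (gP n)) // lerD2l NP.
have Jw : J w <= inf E.
  apply/ler_addgt0Pr => e e0.
  (* If [|g n - w| <= d <= 1], then [J w - J (g n)] is at most [d (1 + 2 |w| + 2 |M|)]; this choice
     of [d] makes that at most [e / 2]. *)
  pose d := Num.min 1 (e / (2 * (1 + 2 * nrm w + 2 * `|M|))).
  have K0 : 0 < 2 * (1 + 2 * nrm w + 2 * `|M|).
    by have := nrm_ge0 w; have := normr_ge0 M; lra.
  have d0 : 0 < d by rewrite lt_min ltr01 divr_gt0.
  have dE : d * (2 * (1 + 2 * nrm w + 2 * `|M|)) <= e.
    by rewrite -ler_pdivlMr // ge_min lexx orbT.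
  have d1 : d <= 1 by rewrite ge_min lexx.
  have [N1 h1] := small (e / 2) (divr_gt0 e0 (ltr0Sn _ 1)).
  have /cvg_nrmP/(_ _ d0) := gw; case=> N2 _ h2.
  pose n := maxn N1 N2.
  have {h2}h2 : nrm (g n - w) <= d by apply: h2; rewrite /= leq_maxr.
  have {h1}h1 : J (g n) <= inf E + e / 2.
    by rewrite (le_trans (gP n)) // lerD2l h1 // leq_maxl.
  have : J w <= J (g n) + e / 2; last lra.
  have hM := ler_norm M.
  have gE : g n = w + (g n - w) by rewrite addrC subrK.
  have i1 : nrm w <= nrm (g n) + d.
    by have := ler_nrmB (g n) (g n - w); rewrite opprB addrC subrK; lra.
  have i2 : phi (g n) = phi w + phi (g n - w) by rewrite -phiD -gE.
  have i3 : phi (g n - w) <= `|M| * d.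
    apply: le_trans (phiM _) _.
    by have := nrm_ge0 (g n - w); have := normr_ge0 M; nra.
  have i4 := nrm_ge0 w; have i5 := nrm_ge0 (g n).
  have i6 : nrm w ^+ 2 - nrm (g n) ^+ 2 <= d * (2 * nrm w + 1).
    have [wg|gw'] := leP (nrm w) (nrm (g n)).
      apply: (@le_trans _ _ 0); last by apply: mulr_ge0; lra.
      by rewrite subr_le0 ler_pXn2r ?nnegrE ?nrm_ge0.
    have wgd : nrm w - nrm (g n) <= d by lra.
    by rewrite subr_sqr; apply: ler_pM => //; lra.
  rewrite /J i2; lra.
exists w => v.
(* Minimality of [w] along the line [w + t v]: a nonnegative quadratic in [t] without constant term
   has no linear term. *)
have key t : 0 <= t ^+ 2 * nrm v ^+ 2 + 2 * t * (ip v w - phi v).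
  have := le_trans Jw (infJ (w + t%:C *: v)).
  rewrite /J phiD phiZ -!ipvv !ipE (ipC w v); lra.
apply/eqP; rewrite eq_sym -subr_eq0; apply/eqP.
set c := _ - _ in key *.
have [v0|v0] := eqVneq (nrm v) 0.
  by have := key (- c); rewrite v0; nra.
have vp : 0 < nrm v ^+ 2 by rewrite exprn_gt0 // lt_def v0 nrm_ge0.
have := key (- c / nrm v ^+ 2).
have -> : (- c / nrm v ^+ 2) ^+ 2 * nrm v ^+ 2 + 2 * (- c / nrm v ^+ 2) * c
   = - (c ^+ 2) / nrm v ^+ 2 by field.
rewrite mulNr oppr_ge0 pmulr_lle0 ?invr_gt0 // => h.
by apply/eqP; rewrite -sqrf_eq0 eq_le h sqr_ge0.
Qed.

End RealHilbert.

(** * Bounded operators, adjoints and compactness *)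

(* Vector identities become scalar ones after pairing with an arbitrary vector. *)
Ltac vec := apply: ip_inj => ?; rewrite !ipE; first [ring | lra].

Section Operators.
Variables (R : realType) (H : hilbertType R).
Implicit Types (u v w : H) (t e M : R) (T S : H -> H).

Lemma innerDr u v w : inner w (u + v) = inner w u + inner w v.
Proof. exact: linearDr. Qed.

Lemma innerZr (a : R[i]) u w : inner w (a *: u) = Num.conj a * inner w u.
Proof. exact: linearZr_LR. Qed.

Lemma inner_inj u v : (forall w, inner w u = inner w v) -> u = v.
Proof. by move=> uv; apply: ip_inj => w; rewrite !(ipC _ w) /ip uv. Qed.

Lemma inner_conj u v : inner u v = Num.conj (inner v u).
Proof. by rewrite hermC /= expr0 mul1r. Qed.

Section Linear.
Variables (T : H -> H) (linT : linear T).

Lemma linopZ a u : T (a *: u) = a *: T u.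
Proof. exact: scalable_linear linT _ _. Qed.

Lemma linopD u v : T (u + v) = T u + T v.
Proof. by have := linT 1 u v; rewrite !scale1r. Qed.

Lemma linop0 : T 0 = 0.
Proof. by have := linopZ 0 0; rewrite !scale0r. Qed.

Lemma linopB u v : T (u - v) = T u - T v.
Proof. by rewrite -scaleN1r linopD linopZ scaleN1r. Qed.

End Linear.

Definition opbound T M := forall v, nrm (T v) <= M * nrm v.
(** A relation in place of [adj], so that adjoints of sums, products and limits can be exhibited
    directly; for linear [T], [adjE] translates back. *)
Definition isadj T S := forall u v, ip (T u) v = ip u (S v).

Lemma opbound_le T M M' : M <= M' -> opbound T M -> opbound T M'.
Proof.
move=> MM' TM v; apply: le_trans (TM v) _.
by rewrite ler_wpM2r ?nrm_ge0.
Qed.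

Lemma bounded_opP T :
  bounded_op T <-> linear T /\ exists2 M, 0 <= M & opbound T M.
Proof.
split=> [[linT [M TM]]|[linT [M M0 TM]]]; split=> //.
  exists `|M| => // v; have := TM v; rewrite !normE -rmorphM lecR.
  by move/le_trans; apply; rewrite ler_wpM2r ?nrm_ge0 // ler_norm.
by exists M => v; rewrite !normE -rmorphM lecR.
Qed.

Lemma opnorm_le T M : 0 <= M -> opbound T M -> opnorm T <= M.
Proof.
move=> M0 TM; apply: ge_sup.
  by exists (nrm (T 0)), 0 => //=; rewrite normr0 ler01.
move=> _ [v /= v1 <-]; apply: le_trans (TM v) _; rewrite -[leRHS]mulr1.
by rewrite ler_wpM2l //; move: v1; rewrite normE lecR.
Qed.

Lemma opboundP T : bounded_op T -> opbound T (opnorm T).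
Proof.
move=> /bounded_opP[linT [M M0 TM]] v.
have [v0|v0] := eqVneq (nrm v) 0.
  by rewrite (nrm_eq0 v0) linop0 // nrm0 mulr0.
have vp : 0 < nrm v by rewrite lt_def v0 nrm_ge0.
rewrite -ler_pdivrMr // mulrC -[X in X * _]ger0_norm ?invr_ge0 ?nrm_ge0 //.
rewrite -nrmZ -linopZ //; apply: ub_le_sup.
  exists M => _ [u /= u1 <-]; apply: le_trans (TM u) _; rewrite -[leRHS]mulr1.
  by rewrite ler_wpM2l //; move: u1; rewrite normE lecR.
exists ((nrm v)^-1%:C *: v) => //=.
by rewrite normE nrmZ ger0_norm ?invr_ge0 ?nrm_ge0 // mulVf.
Qed.

Lemma opnorm_leP T M : bounded_op T -> 0 <= M -> opnorm T <= M <-> opbound T M.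
Proof.
move=> bT M0; split=> [TM|]; last exact: opnorm_le.
exact: opbound_le TM (opboundP bT).
Qed.

Lemma isadj_inner T S : linear T -> isadj T S ->
  forall u v, inner (T u) v = inner u (S v).
Proof.
move=> linT TS u v; rewrite inner_ip TS [RHS]inner_ip; congr Complex; congr (- _).
by rewrite -linopZ // TS.
Qed.

Lemma isadj_linear T S : linear T -> isadj T S -> linear S.
Proof.
move=> linT /(isadj_inner linT) TS a u v; apply: inner_inj => w.
by rewrite -TS !(innerDr, innerZr) !TS.
Qed.

Lemma isadj_sym T S : isadj T S -> isadj S T.
Proof. by move=> TS u v; rewrite ipC -TS ipC. Qed.

(** [|S v|^2 = ip (T (S v)) v <= M |S v| |v|]; divide by [|S v|]. *)
Lemma isadj_opbound T S M : 0 <= M -> isadj T S -> opbound T M -> opbound S M.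
Proof.
move=> M0 TS TM v.
have [v0|v0] := eqVneq (nrm (S v)) 0; first by rewrite v0 mulr_ge0 ?nrm_ge0.
rewrite -(@ler_pM2l _ (nrm (S v))) ?lt_def ?v0 ?nrm_ge0 //.
rewrite -expr2 -ipvv -TS; apply: le_trans (ip_le _ _) _.
by rewrite mulrA [nrm (S v) * M]mulrC ler_wpM2r ?nrm_ge0.
Qed.

Lemma adjE T S : linear T -> isadj T S -> adj T = S.
Proof.
move=> linT /(isadj_inner linT) TS; apply: funext => v.
have : [set S : H -> H | forall u v, inner (T u) v = inner u (S v)] (adj T).
  by apply: (@getI _ _ S).
by move=> /= h; apply: inner_inj => w; rewrite -h TS.
Qed.

(** For fixed [v], [riesz] represents the functional sending [u] to [ip (T u) v]. *)
Lemma isadj_adj T : bounded_op T -> isadj T (adj T).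
Proof.
move=> /bounded_opP[linT [M M0 TM]].
have /choice[S TS] : forall v, exists w, forall u, ip (T u) v = ip u w.
  move=> v; apply: (@riesz _ _ _ (M * nrm v)).
  - by move=> u w; rewrite linopD // ipDl.
  - by move=> t u; rewrite linopZ // ipZl.
  - move=> u; apply: le_trans (ip_le _ _) _.
    by rewrite mulrAC ler_wpM2r ?nrm_ge0.
have {}TS : isadj T S by move=> u v; rewrite TS.
by rewrite (adjE linT TS).
Qed.

Lemma isadj_bounded T S : bounded_op T -> isadj T S -> bounded_op S.
Proof.
move=> /bounded_opP[linT [M M0 TM]] TS; apply/bounded_opP.
by split; [exact: isadj_linear TS|exists M => //; exact: isadj_opbound TM].
Qed.

Definition totally_bounded_op T := forall e, 0 < e -> exists s : seq H,
  forall v, nrm v <= 1 -> exists2 w, w \in s & nrm (T v - w) <= e.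

(** An ultrafilter containing the closure contains one ball of a finite net at every radius, so it
    is Cauchy; completeness gives a limit, which the closed set retains. *)
Lemma totally_bounded_precompact (A : set H) :
  (forall e, 0 < e -> exists s : seq H,
     forall v, A v -> exists2 w, w \in s & nrm (v - w) <= e) -> precompact A.
Proof.
move=> tbA; rewrite precompactE compact_ultra => F UF FA.
have FF : ProperFilter F by exact: ultra_proper.
have small e : 0 < e -> exists w, F [set v | nrm (v - w) <= e].
  (* Half of the radius pays for the passage from [A] to its closure. *)
  move=> e0; have [s sP] := tbA _ (divr_gt0 e0 (ltr0Sn _ 1)).
  have : F [set v | exists2 w, w \in s & nrm (v - w) <= e].
    apply: filterS FA => v /=.
    move=> /(_ [set u | nrm (u - v) <= e / 2]) [].
      have /cvg_nrmP := @cvg_id _ (nbhs v); apply; exact: divr_gt0.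
    move=> u [Au /= uv]; have [w ws uw] := sP _ Au; exists w => //=.
    have -> : v - w = (u - w) - (u - v) by vec.
    by apply: le_trans (ler_nrmB _ _) _; lra.
  elim: s {sP} => [|w s IH] Fs; first by have [v []] := @filter_ex _ F FF _ Fs.
  have [Fw|Fw] := in_ultra_setVsetC [set v | nrm (v - w) <= e] UF.
    by exists w.
  apply: IH; apply: filterS (filterI Fs Fw) => v [[w']].
  by rewrite inE => /orP[/eqP -> //|w's nv _]; exists w'.
have : cvg F.
  apply: (@cauchy_cvg _ F FF); apply: cauchy_exP => e; case: e => e d.
  rewrite ltcE /= => /andP[/eqP -> e0].
  have [w Fw] := small _ (divr_gt0 e0 (ltr0Sn _ 1)); exists w.
  apply: filterS Fw => v /=; rewrite -ball_normE /= normE ltcR nrm_distC.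
  by move=> /le_lt_trans; apply; rewrite ltr_pdivrMr // ltr_pMr // ltr1n.
move=> cF; exists (lim F); split=> //.
by apply: (closed_cvg _ _ FA) => //; exact: closed_closure.
Qed.

Lemma precompact_totally_bounded (A : set H) : precompact A ->
  forall e, 0 < e -> exists s : seq H,
     forall v, A v -> exists2 w, w \in s & nrm (v - w) <= e.
Proof.
rewrite precompactE compact_cover => cA e e0.
have [||D _ Dc] := @cA H (closure A) (fun w => [set v | nrm (v - w) < e]).
- move=> w _; rewrite openE => v /= vw; rewrite /interior /=.
  have evw : 0 < (e - nrm (v - w)) / 2 by rewrite divr_gt0 // subr_gt0.
  have /cvg_nrmP/(_ _ evw) := @cvg_id _ (nbhs v); apply: filterS => u /= uv.
  have -> : u - w = (u - v) + (v - w) by rewrite addrA subrK.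
  by apply: le_lt_trans (ler_nrmD _ _) _; lra.
- by move=> v Av; exists v => //=; rewrite subrr nrm0.
exists (finmap.enum_fset D) => v Av.
have [w wD /= vw] := Dc v (subset_closure Av).
by exists w => //; exact: ltW.
Qed.

Lemma compact_opP T : compact_op T <-> bounded_op T /\ totally_bounded_op T.
Proof.
split=> [[bT cT]|[bT cT]]; split=> //.
  move=> e /(precompact_totally_bounded cT)[s sP]; exists s => v v1.
  by apply: sP; exists v => //=; rewrite normE lecR.
apply: totally_bounded_precompact => e /cT[s sP]; exists s => _ [v /= v1 <-].
by apply: sP; move: v1; rewrite normE lecR.
Qed.

End Operators.

(** * Algebra of bounded and compact operators *)

Section CompactOperators.
Variables (R : realType) (H : hilbertType R).
Implicit Types (u v w : H) (t e M : R) (T S C : H -> H).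

Lemma linear_add T S : linear T -> linear S -> linear (fun v => T v + S v).
Proof.
move=> linT linS a u v /=.
by rewrite linT linS scalerDr addrACA.
Qed.

Lemma linear_scale t T : linear T -> linear (fun v => t%:C *: T v).
Proof.
move=> linT a u v /=.
by rewrite linT scalerDr !scalerA [_ * a]mulrC.
Qed.

Lemma linear_comp T S : linear T -> linear S -> linear (fun v => T (S v)).
Proof. by move=> linT linS a u v; rewrite /= linS linT. Qed.

Lemma opbound_add T S M N : opbound T M -> opbound S N ->
  opbound (fun v => T v + S v) (M + N).
Proof.
move=> TM SN v; apply: le_trans (ler_nrmD _ _) _.
by rewrite mulrDl lerD.
Qed.

Lemma opbound_scale t T M : opbound T M ->
  opbound (fun v => t%:C *: T v) (`|t| * M).
Proof. by move=> TM v; rewrite nrmZ -mulrA ler_wpM2l. Qed.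

Lemma opbound_comp T S M N : 0 <= M -> opbound T M -> opbound S N ->
  opbound (fun v => T (S v)) (M * N).
Proof.
move=> M0 TM SN v; apply: le_trans (TM _) _.
by rewrite -mulrA ler_wpM2l.
Qed.

Lemma bounded_op_add T S : bounded_op T -> bounded_op S ->
  bounded_op (fun v => T v + S v).
Proof.
move=> /bounded_opP[linT [M M0 TM]] /bounded_opP[linS [N N0 SN]].
apply/bounded_opP; split; first exact: linear_add.
by exists (M + N); [exact: addr_ge0|exact: opbound_add].
Qed.

Lemma bounded_op_scale t T : bounded_op T -> bounded_op (fun v => t%:C *: T v).
Proof.
move=> /bounded_opP[linT [M M0 TM]].
apply/bounded_opP; split; first exact: linear_scale.
by exists (`|t| * M); [exact: mulr_ge0|exact: opbound_scale].
Qed.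

Lemma bounded_op_comp T S : bounded_op T -> bounded_op S ->
  bounded_op (fun v => T (S v)).
Proof.
move=> /bounded_opP[linT [M M0 TM]] /bounded_opP[linS [N N0 SN]].
apply/bounded_opP; split; first exact: linear_comp.
by exists (M * N); [exact: mulr_ge0|exact: opbound_comp].
Qed.

Lemma bounded_op_id : bounded_op (fun v => v).
Proof.
by apply/bounded_opP; split=> //; exists 1 => // v; rewrite mul1r.
Qed.

Lemma compact_op_add T S : compact_op T -> compact_op S ->
  compact_op (fun v => T v + S v).
Proof.
move=> /compact_opP[bT cT] /compact_opP[bS cS]; apply/compact_opP.
split=> [|e e0]; first exact: bounded_op_add.
have e20 : 0 < e / 2 by rewrite divr_gt0.
have [s sP] := cT _ e20; have [s' s'P] := cS _ e20.
exists [seq u + w | u <- s, w <- s'] => v v1.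
have [u us Tu] := sP v v1; have [w ws Sw] := s'P v v1.
exists (u + w); first by apply/allpairsP; exists (u, w).
have -> : T v + S v - (u + w) = (T v - u) + (S v - w) by vec.
by apply: le_trans (ler_nrmD _ _) _; lra.
Qed.

Lemma compact_op_compl T S : compact_op T -> bounded_op S ->
  compact_op (fun v => S (T v)).
Proof.
move=> /compact_opP[bT cT] bS; apply/compact_opP.
split=> [|e e0]; first exact: bounded_op_comp.
have [linS [M M0 SM]] := (bounded_opP S).1 bS.
(* [M] may be 0; dividing by [M + 1] avoids a case distinction, here and in similar estimates. *)
have M1 : 0 < M + 1 by rewrite ltr_wpDl.
have [s sP] := cT (e / (M + 1)) (divr_gt0 e0 M1).
exists (map S s) => v /sP[w ws Tw]; exists (S w); first exact: map_f.
rewrite -(linopB linS); apply: le_trans (SM _) _.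
move: Tw; rewrite ler_pdivlMr //; have := nrm_ge0 (T v - w); nra.
Qed.

Lemma compact_op_scale t T : compact_op T -> compact_op (fun v => t%:C *: T v).
Proof.
move=> cT; apply: (compact_op_compl cT).
exact: (bounded_op_scale _ bounded_op_id).
Qed.

Lemma compact_op_compr T S : compact_op T -> bounded_op S ->
  compact_op (fun v => T (S v)).
Proof.
move=> /compact_opP[bT cT] bS; apply/compact_opP.
split=> [|e e0]; first exact: bounded_op_comp.
have [linS [M M0 SM]] := (bounded_opP S).1 bS; have linT := bT.1.
have M1 : 0 < M + 1 by rewrite ltr_wpDl.
have [s sP] := cT (e / (M + 1)) (divr_gt0 e0 M1).
exists [seq (M + 1)%:C *: w | w <- s] => v v1.
have [|w ws Tw] := sP ((M + 1)^-1%:C *: S v).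
  rewrite nrmZ ger0_norm ?invr_ge0 ?(ltW M1) // mulrC ler_pdivrMr // mul1r.
  by apply: le_trans (SM _) _; have := nrm_ge0 v; nra.
exists ((M + 1)%:C *: w); first exact: map_f.
have -> : T (S v) - (M + 1)%:C *: w =
    (M + 1)%:C *: (T ((M + 1)^-1%:C *: S v) - w).
  rewrite (linopZ linT) scalerBr scalerA -rmorphM mulfV ?gt_eqF //.
  by rewrite rmorph1 scale1r.
by rewrite nrmZ gtr0_norm // mulrC -ler_pdivlMr.
Qed.

Lemma compact_op_lim T : linear T ->
  (forall e, 0 < e -> exists2 T', compact_op T' & opbound (fun v => T v - T' v) e) ->
  compact_op T.
Proof.
move=> linT hT; apply/compact_opP; split=> [|e e0].
  have [T' [/bounded_opP[linT' [M M0 T'M]] _ TT']] := hT 1 ltr01.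
  apply/bounded_opP; split=> //; exists (1 + M); first by rewrite addr_ge0.
  move=> v; have := opbound_add TT' T'M v; rewrite subrK; exact.
have e20 : 0 < e / 2 by rewrite divr_gt0.
have [T' /compact_opP[_ cT'] TT'] := hT _ e20.
have [s sP] := cT' _ e20; exists s => v v1; have [w ws Tw] := sP v v1.
exists w => //; have -> : T v - w = (T v - T' v) + (T' v - w) by vec.
by apply: le_trans (ler_nrmD _ _) _; have := TT' v; nra.
Qed.

Lemma compact_op0 : compact_op (fun=> 0 : H).
Proof.
have b0 : bounded_op (fun=> 0 : H).
  apply/bounded_opP; split=> [a u v|]; first by rewrite scaler0 addr0.
  by exists 0 => // v; rewrite nrm0 mul0r.
apply/compact_opP; split=> // e e0; exists [:: 0] => v _; exists 0.
  by rewrite inE.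
by rewrite subrr nrm0 ltW.
Qed.

(** The values [phi v] lie in [[-M, M]]; the net is an arithmetic progression of step [d] in that
    interval, times [w]. *)
Lemma totally_bounded_rank1 (phi : H -> R) M w :
  (forall v, nrm v <= 1 -> `|phi v| <= M) ->
  totally_bounded_op (fun v => (phi v)%:C *: w).
Proof.
move=> phiM e e0.
have w1 : 0 < nrm w + 1 by have := nrm_ge0 w; lra.
pose d := e / (nrm w + 1); have d0 : 0 < d by rewrite divr_gt0.
exists [seq (n%:R * d - M)%:C *: w | n <- iota 0 (Num.truncn (2 * M / d)).+1] => v v1.
have /ler_normlP[pM Mp] := phiM v v1.
have pd0 : 0 <= (phi v + M) / d by rewrite divr_ge0 ?(ltW d0) //; lra.
pose n := Num.truncn ((phi v + M) / d).
exists ((n%:R * d - M)%:C *: w).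
  apply/mapP; exists n => //; rewrite mem_iota /= add0n ltnS.
  by apply: le_truncn; rewrite ler_pM2r ?invr_gt0 //; lra.
rewrite -scalerBl -rmorphB nrmZ.
have /andP[n1 n2] := truncn_itv pd0.
move: n1 n2; rewrite -/n ler_pdivlMr // ltr_pdivrMr // -natr1 => n1 n2.
have : `|phi v - (n%:R * d - M)| <= d by rewrite ler_norml; lra.
have : d * (nrm w + 1) = e by rewrite divfK ?gt_eqF.
have := nrm_ge0 w; have := normr_ge0 (phi v - (n%:R * d - M)); nra.
Qed.

(** The complex coefficient is split into real and imaginary parts, giving two real rank-one maps,
    along [u] and along ['i *: u]. For a unit vector [u] this is the orthogonal projection onto its
    span. *)
Lemma compact_rank1 u : compact_op (fun v => inner v u *: u).
Proof.
have E v : inner v u *: u = (ip v u)%:C *: u + (- ip ('i *: v) u)%:C *: ('i *: u).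
  rewrite inner_ip scalerA -scalerDl; congr (_ *: _).
  by apply/eqP; rewrite eq_complex /=; apply/andP; split; apply/eqP; ring.
have nrmi v : nrm ('i *: v) = nrm v.
  by apply: complexI; rewrite -!normE normrZ normc_def /= expr0n expr1n
    add0r sqrtr1 mul1r.
have ip1 v w : nrm v <= 1 -> `|ip v w| <= nrm w.
  move=> v1; rewrite ler_norml; have := ip_le v w; have := ip_le (- v) w.
  by rewrite ipNl nrmN; have := nrm_ge0 w; nra.
apply/compact_opP; split.
  apply/bounded_opP; split=> [a v w|].
    by rewrite innerDl innerZl scalerDl scalerA.
  exists (2 * nrm u * nrm u); first by rewrite !mulr_ge0 ?nrm_ge0.
  move=> v; rewrite E; apply: le_trans (ler_nrmD _ _) _; rewrite !nrmZ nrmi normrN.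
  have B w : `|ip w u| <= nrm w * nrm u.
    rewrite ler_norml ip_le andbT lerNl -ipNl.
    by apply: le_trans (ip_le _ _) _; rewrite nrmN.
  have := B v; have := B ('i *: v); rewrite nrmi; have := nrm_ge0 u; nra.
move=> e e0; have e20 : 0 < e / 2 by rewrite divr_gt0.
have [s sP] := totally_bounded_rank1 u (fun v => ip1 v u) e20.
have h v : nrm v <= 1 -> `|- ip ('i *: v) u| <= nrm u.
  by move=> v1; rewrite normrN ip1 // nrmi.
have [s' s'P] := totally_bounded_rank1 ('i *: u) h e20.
exists [seq x + y | x <- s, y <- s'] => v v1; rewrite E.
have [x xs nx] := sP v v1; have [y ys ny] := s'P v v1.
exists (x + y); first by apply/allpairsP; exists (x, y).
rewrite opprD addrACA; apply: le_trans (ler_nrmD _ _) _; lra.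
Qed.

Lemma isadj_rank1 u : isadj (fun v => inner v u *: u) (fun v => inner v u *: u).
Proof.
move=> v w; rewrite /ip innerZl innerZr -inner_conj.
by rewrite mulrC.
Qed.

End CompactOperators.

(** * Eigenvectors and compact perturbations of almost symmetries *)

Section Eigenvectors.
Variables (R : realType) (H : hilbertType R).
Implicit Types (u v w : H) (t e M : R) (T S C : H -> H).

Lemma ler_mul_small (x K : R) : 0 <= K ->
  (forall d, 0 < d -> d <= 1 -> x <= K * d) -> x <= 0.
Proof.
move=> K0 h; rewrite leNgt; apply/negP => x0.
have Kx : 0 < 2 * (K + x) by lra.
have d0 : 0 < x / (2 * (K + x)) by rewrite divr_gt0.
have d1 : x / (2 * (K + x)) <= 1 by rewrite ler_pdivrMr //; lra.
have := h _ d0 d1; rewrite mulrA ler_pdivlMr //; nra.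
Qed.

(* A cluster point of [C v_n], for a sequence of unit vectors along which the
   norm of [C] is approached, is an eigenvector of [C^2]. *)
Lemma compact_eigenvector C (q : R) : compact_op C -> isadj C C -> 0 < q ->
  ~ opbound C q -> exists w lam, [/\ w <> 0, q <= `|lam| & C w = lam%:C *: w].
Proof.
move=> cC adjC q0 nq; have [bC pC] := cC; have linC := bC.1.
have CM := opboundP bC; set mu := opnorm C in CM.
have qmu : q < mu.
  by rewrite ltNge; apply/negP => /(opnorm_leP bC (ltW q0)).
have mu0 : 0 < mu by exact: lt_trans qmu.
have /choice[g gP] : forall n : nat, exists v,
    nrm v <= 1 /\ mu - n.+1%:R^-1 <= nrm (C v).
  move=> n; have n0 : 0 < n.+1%:R^-1 :> R by rewrite invr_gt0.
  pose E := [set complex.Re `|C v| | v in [set v : H | `|v| <= 1]].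
  have hE : has_sup E.
    split; first by exists (nrm (C 0)), 0 => //=; rewrite normr0 ler01.
    exists mu => _ [u /= u1 <-]; apply: le_trans (CM u) _; rewrite -[leRHS]mulr1.
    by rewrite ler_wpM2l ?(ltW mu0) //; move: u1; rewrite normE lecR.
  have [_ [v /= v1 <-] /ltW hv] := sup_adherent n0 hE.
  by exists v; split => //; move: v1; rewrite normE lecR.
(* A cluster point in place of a convergent subsequence: at each precision some [v] nearly attains
   the norm while [C v] is close to [y]. *)
have [y ey] : exists y, forall e, 0 < e -> exists v,
    [/\ nrm v <= 1, mu - e <= nrm (C v) & nrm (C v - y) <= e].
  move: pC; rewrite precompactE => pC.
  have [|y [_ cy]] := pC ((fun n => C (g n)) @ \oo) _ _.
    exists 0%N => // n _; apply: subset_closure; exists (g n) => //=.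
    by rewrite normE lecR; case: (gP n).
  exists y => e e0.
  have nN : \forall n \near \oo, n.+1%:R^-1 <= e.
    exists (Num.truncn e^-1) => // n Nn.
    rewrite invf_ple ?posrE // ltW // (lt_le_trans (truncnS_gt _)) //.
    by rewrite ler_nat.
  have [||] := cy [set x | exists n, x = C (g n) /\ n.+1%:R^-1 <= e]
             [set x | nrm (x - y) <= e].
  - by apply: filterS nN => n ne; exists n.
  - by have /cvg_nrmP := @cvg_id _ (nbhs y); apply.
  - move=> x [[n [-> ne]] /= ny]; exists (g n); have [g1 g2] := gP n.
    by split=> //; apply: le_trans g2; rewrite lerD2l lerN2.
have Cle u : nrm u <= 1 -> nrm (C u) <= mu.
  by move=> u1; apply: le_trans (CM u) _; rewrite ler_piMr // ltW.
(* Expanding the square gives [|C (C v)|^2 - 2 mu^2 |C v|^2 + mu^4 |v|^2], and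
   [|C (C v)| <= mu |C v|]. *)
have CC v : nrm v <= 1 ->
    nrm (C (C v) - (mu ^+ 2)%:C *: v) ^+ 2 <= mu ^+ 2 * (mu ^+ 2 - nrm (C v) ^+ 2).
  move=> v1; rewrite -ipvv !ipE !ipvv -adjC ipC -adjC !ipvv.
  have a1 : nrm (C (C v)) ^+ 2 <= mu ^+ 2 * nrm (C v) ^+ 2.
    by rewrite -exprMn ler_pXn2r ?nnegrE ?mulr_ge0 ?nrm_ge0 ?(ltW mu0).
  have a2 : nrm v ^+ 2 <= 1 by rewrite expr_le1 ?nrm_ge0.
  have a3 : 0 <= mu ^+ 2 by rewrite sqr_ge0.
  nra.
have CCy : C (C y) = (mu ^+ 2)%:C *: y.
  apply/eqP; rewrite -subr_eq0; apply/eqP/nrm_eq0/eqP.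
  rewrite eq_le nrm_ge0 andbT.
  pose K := 2 * mu ^+ 2 + mu.
  have K0 : 0 <= K by rewrite /K addr_ge0 ?mulr_ge0 ?sqr_ge0 ?ltW.
  apply: (ler_mul_small K0) => d d0 d1.
  (* By [CC], the square of [C (C v) - mu^2 v] is at most [mu^2 (2 mu e)], hence at most [d^2]. The
     three terms below are then at most [mu d], [mu^2 d] and [mu^2 d], which add up to [K d]. *)
  pose e := Num.min d (d ^+ 2 / (2 * mu ^+ 3)).
  have e0 : 0 < e.
    by rewrite lt_min d0 divr_gt0 ?exprn_gt0 ?mulr_gt0 ?exprn_gt0.
  have ed : e <= d by rewrite ge_min lexx.
  have ed2 : e * (2 * mu ^+ 3) <= d ^+ 2.
    by rewrite -ler_pdivlMr ?mulr_gt0 ?exprn_gt0 // ge_min lexx orbT.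
  have [v [v1 v2 v3]] := ey _ e0.
  have -> : C (C y) - (mu ^+ 2)%:C *: y = C (C (C v) - (mu ^+ 2)%:C *: v) +
      (C (C (y - C v)) + (mu ^+ 2)%:C *: (C v - y)).
    by rewrite !(linopB linC) (linopZ linC); vec.
  apply: le_trans (ler_nrmD _ _) _.
  have b1 : nrm (C (C (C v) - (mu ^+ 2)%:C *: v)) <= mu * d.
    apply: le_trans (CM _) _; rewrite ler_pM2l //.
    rewrite -(@ler_pXn2r _ 2) ?nnegrE ?nrm_ge0 ?(ltW d0) //.
    apply: le_trans (CC v v1) _; apply: le_trans ed2.
    have c1 := Cle v v1; have c2 := nrm_ge0 (C v).
    have c3 : mu ^+ 2 - nrm (C v) ^+ 2 <= e * (2 * mu).
      by rewrite subr_sqr; apply: ler_pM; lra.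
    have -> : e * (2 * mu ^+ 3) = mu ^+ 2 * (e * (2 * mu)) by ring.
    by rewrite ler_wpM2l ?sqr_ge0.
  have b2 : nrm (C (C (y - C v))) <= mu * (mu * d).
    apply: le_trans (CM _) _; rewrite ler_pM2l //.
    apply: le_trans (CM _) _; rewrite ler_pM2l //.
    by rewrite nrm_distC (le_trans v3).
  have b3 : nrm ((mu ^+ 2)%:C *: (C v - y)) <= mu ^+ 2 * d.
    rewrite nrmZ ger0_norm ?sqr_ge0 // ler_wpM2l ?sqr_ge0 //.
    exact: le_trans ed.
  have := ler_nrmD (C (C (y - C v))) ((mu ^+ 2)%:C *: (C v - y)).
  rewrite /K; lra.
have y0 : y <> 0.
  move=> y0; have [v [_ v2 v3]] := ey _ (divr_gt0 mu0 (ltr0Sn _ 2)).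
  by move: v3; rewrite y0 subr0; lra.
(* [(C - mu) (C + mu) y = 0]: either [C + mu] kills [y], or [C y + mu y] is an eigenvector for
   [mu]. *)
have [Cy|Cy] := pselect (C y = (- mu)%:C *: y).
  by exists y, (- mu); split=> //; rewrite normrN gtr0_norm // ltW.
exists (C y + mu%:C *: y), mu; split.
- move=> w0; apply: Cy; apply/eqP; rewrite -subr_eq0 -w0; apply/eqP; vec.
- by rewrite gtr0_norm // ltW.
- by rewrite (linopD linC) (linopZ linC) CCy; vec.
Qed.

(** An eigenvector [w] of [S^2 - 1] for [lam] satisfies [S^2 w = r^2 w] with [r^2 = 1 + lam], which
    is nonnegative because [ip (S (S w)) w = |S w|^2]. Factoring [S^2 - r^2] yields an eigenvector
    of [S] for [r] or [- r]. *)
Lemma symmetry_eigenvector S (q : R) : bounded_op S -> isadj S S -> 0 < q ->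
  compact_op (fun v => S (S v) - v) -> ~ opbound (fun v => S (S v) - v) q ->
  exists u r, [/\ nrm u = 1, q <= `|r ^+ 2 - 1| & S u = r%:C *: u].
Proof.
move=> bS adjS q0 cC nq; have linS := bS.1.
have adjC : isadj (fun v => S (S v) - v) (fun v => S (S v) - v).
  by move=> u v; rewrite !ipE !adjS.
have [w [lam [w0 qlam Cw]]] := compact_eigenvector cC adjC q0 nq.
have SSw : S (S w) = (1 + lam)%:C *: w.
  by rewrite -[LHS](subrK w) Cw; vec.
have wp : 0 < nrm w ^+ 2.
  rewrite exprn_gt0 // lt_def nrm_ge0 andbT.
  by apply/eqP => /nrm_eq0.
have lam1 : 0 <= 1 + lam.
  have : 0 <= ip (S w) (S w) by rewrite ipvv sqr_ge0.
  by rewrite -adjS SSw ipZl ipvv pmulr_lge0.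
pose r := Num.sqrt (1 + lam); have r2 : r ^+ 2 = 1 + lam by rewrite sqr_sqrtr.
have {}SSw : S (S w) = (r ^+ 2)%:C *: w by rewrite r2.
have [u [r' [u0 r'2 Su]]] : exists u r', [/\ u <> 0, r' ^+ 2 = r ^+ 2 & S u = r'%:C *: u].
  have [Sw|Sw] := pselect (S w = (- r)%:C *: w).
    by exists w, (- r); rewrite sqrrN.
  exists (S w + r%:C *: w), r; split=> //.
    by move=> h; apply: Sw; apply/eqP; rewrite -subr_eq0 -h; apply/eqP; vec.
  by rewrite (linopD linS) (linopZ linS) SSw; vec.
have un : 0 < nrm u.
  by rewrite lt_def nrm_ge0 andbT; apply/eqP => /nrm_eq0.
exists ((nrm u)^-1%:C *: u), r'; split.
- by rewrite nrmZ ger0_norm ?invr_ge0 ?ltW // mulVf ?gt_eqF.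
- by rewrite r'2 r2 addrAC subrr add0r.
- by rewrite (linopZ linS) Su; vec.
Qed.

(** For distinct members [u], [w] of [l] with eigenvalues [a], [b],
    [|C u - C w|^2 = a^2 + b^2 >= 2 q^2], so the two images cannot share a net point at distance
    [q / 2]. Hence [l] injects into [s]. *)
Lemma orthonormal_size_bound C (q : R) (s l : seq H) : 0 < q ->
  (forall v, nrm v <= 1 -> exists2 w, w \in s & nrm (C v - w) <= q / 2) ->
  uniq l -> (forall u, u \in l ->
    nrm u = 1 /\ exists2 lam, q <= `|lam| & C u = lam%:C *: u) ->
  (forall u w, u \in l -> w \in l -> u != w -> inner u w = 0) ->
  (size l <= size s)%N.
Proof.
move=> q0 sP ul lP lO.
have /choice[f fP] : forall v, exists w, nrm v <= 1 -> w \in s /\ nrm (C v - w) <= q / 2.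
  move=> v; have [v1|v1] := pselect (nrm v <= 1); last by exists 0.
  by have [w] := sP v v1; exists w.
have l1 u : u \in l -> nrm u <= 1 by move=> /lP[-> _].
rewrite -(size_map f); apply: uniq_leq_size; last first.
  by move=> _ /mapP[u /l1 u1 ->]; case: (fP u u1).
rewrite map_inj_in_uniq // => u w ul' wl fuw; apply/eqP/negPn/negP => uw.
have [_ hu] := fP u (l1 _ ul'); have [_ hw] := fP w (l1 _ wl).
have : nrm (C u - C w) <= q.
  have -> : C u - C w = (C u - f u) - (C w - f w) by rewrite fuw; vec.
  by apply: le_trans (ler_nrmB _ _) _; lra.
have [nu [a qa ->]] := lP _ ul'; have [nw [b qb ->]] := lP _ wl.
rewrite -(@ler_pXn2r _ 2) ?nnegrE ?nrm_ge0 ?(ltW q0) //.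
rewrite -ipvv !ipE (ipC w u) {2 3}/ip (lO _ _ ul' wl uw) !ipvv nu nw.
have ha : q ^+ 2 <= a ^+ 2.
  by rewrite -(real_normK (num_real a)) ler_pXn2r ?nnegrE ?(ltW q0).
have hb : q ^+ 2 <= b ^+ 2.
  by rewrite -(real_normK (num_real b)) ler_pXn2r ?nnegrE ?(ltW q0).
have hq : 0 < q ^+ 2 by rewrite exprn_gt0.
rewrite /=; nra.
Qed.

(* While [(S + K)^2 - 1] is not small it has an eigenvector [u] which is also an
   eigenvector of [S], and adding a multiple of the projection onto [u] to [K]
   makes [u] a fixed vector of [S + K]. The vectors found in this way are
   orthonormal, and compactness of [S^2 - 1] bounds their number. *)
Lemma compact_perturbation_symmetry S (q : R) :
  bounded_op S -> isadj S S -> compact_op (fun v => S (S v) - v) -> 0 < q ->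
  exists K, [/\ compact_op K, isadj K K &
    opbound (fun v => S (S v + K v) + K (S v + K v) - v) q].
Proof.
move=> bS adjS cC q0; apply: contrapT => nK.
pose C v := S (S v) - v.
have [_ tbC] := (compact_opP C).1 cC.
have [s sP] := tbC _ (divr_gt0 q0 (ltr0Sn _ 1)).
(* The net [s] belongs to the fixed operator [C], while [K] changes along the induction; hence the
   members of [l] are required to be eigenvectors of [C]. The last clause makes a new eigenvector of
   [S + K], being orthogonal to [l], an eigenvector of [S] itself. *)
suff : forall n, exists l K, [/\ size l = n /\ uniq l,
    compact_op K /\ isadj K K,
    forall u, u \in l -> [/\ nrm u = 1, S u + K u = u &
      exists2 lam, q <= `|lam| & C u = lam%:C *: u],
    forall u w, u \in l -> w \in l -> u != w -> inner u w = 0 &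
    forall v, (forall w, w \in l -> inner v w = 0) -> K v = 0].
  move=> /(_ (size s).+1)[l [K [[ls ul] _ lP lO _]]].
  have := orthonormal_size_bound q0 sP ul _ lO; rewrite ls ltnn => h.
  by have := h (fun u ulm => let: And3 a _ b := lP u ulm in conj a b).
elim=> [|n [l [K [[ls ul] [cK adjK] lP lO K0]]]].
  exists [::], (fun=> 0); split=> //; split=> //; first exact: compact_op0.
  by move=> u v; rewrite ip0l ip0r.
pose T v := S v + K v; have bT : bounded_op T by apply: bounded_op_add bS cK.1.
have adjT : isadj T T by move=> u v; rewrite !ipE adjS adjK.
have linT := bT.1; have linS := bS.1; have linK := cK.1.1.
have cT : compact_op (fun v => T (T v) - v).
  have -> : (fun v => T (T v) - v) = (fun v => C v + (K (S v) + (S (K v) + K (K v)))).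
    by apply: funext => v; rewrite /C /T (linopD linS) (linopD linK); vec.
  apply: compact_op_add => //; apply: compact_op_add.
    exact: compact_op_compr.
  apply: compact_op_add; first exact: compact_op_compl.
  exact: compact_op_compl cK cK.1.
have nT : ~ opbound (fun v => T (T v) - v) q by move=> h; apply: nK; exists K.
have [u [r [u1 qr Tu]]] := symmetry_eigenvector bT adjT q0 cT nT.
have r1 : r - 1 <> 0.
  move=> r1; move: qr; rewrite (_ : r ^+ 2 - 1 = (r - 1) * (r + 1)); last by ring.
  by rewrite r1 mul0r normr0 leNgt q0.
(* Members of [l] are fixed by the self-adjoint [T], and [u] belongs to an eigenvalue [r] other than
   1. *)
have ou w : w \in l -> inner u w = 0.
  move=> /lP[_ Tw _].
  have h : inner (T u) w = inner u w by rewrite (isadj_inner linT adjT) /T Tw.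
  have {h}: (r - 1)%:C * inner u w = 0.
    by rewrite rmorphB rmorph1 mulrBl mul1r -innerZl -Tu h subrr.
  move/eqP; rewrite mulf_eq0 => /orP[/eqP|/eqP //].
  by move=> /(congr1 (@complex.Re R)) /=.
have ou' w : w \in l -> inner w u = 0.
  by move=> wl; rewrite inner_conj ou // rmorph0.
have Ku : K u = 0 by exact: K0.
have Su : S u = r%:C *: u by rewrite -Tu /T Ku addr0.
have uu : inner u u = 1 by rewrite innerE normE u1 expr1n.
exists (u :: l), (fun v => K v + (1 - r)%:C *: (inner v u *: u)); split.
- split=> /=; first by rewrite ls.
  rewrite ul andbT; apply/negP => /ou; rewrite uu => /eqP.
  by rewrite oner_eq0.
- split.
    by apply: compact_op_add => //; apply/compact_op_scale/compact_rank1.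
  by move=> v w; rewrite !ipE adjK isadj_rank1.
- move=> w; rewrite inE => /orP[/eqP ->|wl].
    split=> //.
      by rewrite Ku Su uu scale1r; vec.
    by exists (r ^+ 2 - 1) => //; rewrite /C Su (linopZ linS) Su; vec.
  have [w1 Tw Cw] := lP w wl; split=> //.
  by rewrite ou' // scale0r scaler0 addr0.
- move=> v w; rewrite !inE => /orP[/eqP ->|vl] /orP[/eqP ->|wl].
  + by rewrite eqxx.
  + by rewrite ou.
  + by rewrite ou'.
  + exact: lO.
- move=> v vl; rewrite K0 => [|w wl]; last by rewrite vl // inE wl orbT.
  by rewrite vl ?inE ?eqxx // scale0r scaler0 addr0.
Qed.

End Eigenvectors.

(** * Operator families *)

Section Families.
Variables (R : realType) (H : hilbertType R).
Implicit Types (u v w : H) (t e M : R) (T S : H -> H) (D : set R).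
Implicit Types (a f g k : R -> H -> H) (F : set_system R).

(** Convergence to 0 in operator norm, phrased through [opbound] to avoid the supremum in [opnorm];
    [norm_nullP] relates the two. *)
Definition norm_null F g :=
  forall e, 0 < e -> \forall y \near F, opbound (g y) e.

(** One half of strong-* continuity; for self-adjoint families it is all of it, see
    [CbB_selfadjoint]. *)
Definition strong_continuous D f := forall x v e, D x -> 0 < e ->
  \forall y \near within D (nbhs x), nrm (f y v - f x v) <= e.

Lemma withinS D F {FF : Filter F} (P Q : R -> Prop) :
  (forall y, D y -> P y -> Q y) ->
  (\forall y \near within D F, P y) -> \forall y \near within D F, Q y.
Proof.
move=> PQ h.
by apply: (@filterS _ F FF _ _ _ h) => y hy Dy; apply: PQ => //; exact: hy.
Qed.

Lemma withinS2 D F {FF : Filter F} (P P' Q : R -> Prop) :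
  (forall y, D y -> P y -> P' y -> Q y) ->
  (\forall y \near within D F, P y) -> (\forall y \near within D F, P' y) ->
  \forall y \near within D F, Q y.
Proof.
move=> PQ h h'; apply: (@filterS2 _ F FF _ _ _ _ h h') => y hy hy' Dy.
by apply: PQ => //; [exact: hy|exact: hy'].
Qed.

Lemma withinT D F {FF : Filter F} (P : R -> Prop) :
  (forall y, D y -> P y) -> \forall y \near within D F, P y.
Proof. by move=> h; apply: (@nearW _ F _ FF) => y; exact: h. Qed.

Lemma near_seq (I : eqType) F {FF : Filter F} (s : seq I) (P : I -> R -> Prop) :
  (forall i, \forall y \near F, P i y) ->
  \forall y \near F, forall i, i \in s -> P i y.
Proof.
move=> h; elim: s => [|i s IH]; first exact: nearW.
apply: filterS2 (h i) IH => y Pi Ps j.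
by rewrite inE => /orP[/eqP ->|/Ps].
Qed.

Lemma opnorm_ge0 T : bounded_op T -> 0 <= opnorm T.
Proof.
move=> bT; have [linT [M M0 TM]] := (bounded_opP T).1 bT.
rewrite -(@nrm0 R H) -(linop0 linT); apply: ub_le_sup.
  exists M => _ [u /= u1 <-]; apply: le_trans (TM u) _; rewrite -[leRHS]mulr1.
  by rewrite ler_wpM2l //; move: u1; rewrite normE lecR.
by exists 0 => //=; rewrite normr0 ler01.
Qed.

Lemma opbound_unit T M : linear T -> 0 <= M ->
  (forall v, nrm v <= 1 -> nrm (T v) <= M) -> opbound T M.
Proof.
move=> linT M0 TM v.
have [v0|v0] := eqVneq (nrm v) 0; first by rewrite (nrm_eq0 v0) linop0 // nrm0 mulr0.
have vp : 0 < nrm v by rewrite lt_def v0 nrm_ge0.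
rewrite -ler_pdivrMr // mulrC -[X in X * _]ger0_norm ?invr_ge0 ?nrm_ge0 //.
rewrite -nrmZ -(linopZ linT) TM // nrmZ ger0_norm ?invr_ge0 ?nrm_ge0 //.
by rewrite mulVf.
Qed.

Lemma norm_nullP F {FF : Filter F} g : (\forall y \near F, bounded_op (g y)) ->
  opnorm (g y) @[y --> F] --> (0 : R) <-> norm_null F g.
Proof.
move=> bg; split=> [/cvgrPdist_le h e e0|h].
  apply: filterS2 bg (h e e0) => y bgy; rewrite sub0r normrN => hy.
  apply/opnorm_leP => //; first exact: ltW.
  exact: le_trans (ler_norm _) hy.
apply/cvgrPdist_le => e e0; apply: filterS2 bg (h e e0) => y bgy gy.
by rewrite sub0r normrN ger0_norm ?opnorm_ge0 // opnorm_le // ltW.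
Qed.

Lemma bounded_op_sub T S : bounded_op T -> bounded_op S ->
  bounded_op (fun v => T v - S v).
Proof.
move=> bT bS; have := bounded_op_add bT (bounded_op_scale (-1) bS).
by congr bounded_op; apply: funext => v; vec.
Qed.

Lemma C0KP D g : C0K D g <->
  [/\ forall x, D x -> compact_op (g x),
      forall x, D x ->
        norm_null (within D (nbhs x)) (fun y v => g y v - g x v),
      norm_null (within D (pinfty_nbhs R)) g
    & norm_null (within D (ninfty_nbhs R)) g].
Proof.
split=> [[cg ng [pg mg]]|[cg ng pg mg]].
  have bg F (FF : Filter F) : \forall y \near within D F, bounded_op (g y).
    by apply: withinT => y /cg[].
  split=> //; [|exact: (norm_nullP (bg _ _)).1 pg|exact: (norm_nullP (bg _ _)).1 mg].
  move=> x Dx; apply/norm_nullP; last exact: ng.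
  by apply: withinT => y Dy; apply: bounded_op_sub; [case: (cg y)|case: (cg x)].
have bg F (FF : Filter F) : \forall y \near within D F, bounded_op (g y).
  by apply: withinT => y /cg[].
split=> //; last first.
  by split; [exact: (norm_nullP (bg _ _)).2 pg|exact: (norm_nullP (bg _ _)).2 mg].
move=> x Dx; apply/norm_nullP; last exact: ng.
by apply: withinT => y Dy; apply: bounded_op_sub; [case: (cg y)|case: (cg x)].
Qed.

Lemma norm_null_eq F f g : (forall y v, f y v = g y v) ->
  norm_null F f -> norm_null F g.
Proof. by move=> fg; rewrite (_ : f = g) //; apply/funext => y; apply/funext. Qed.

Lemma norm_null_add F {FF : Filter F} f g :
  norm_null F f -> norm_null F g -> norm_null F (fun y v => f y v + g y v).
Proof.
move=> hf hg e e0; have e20 : 0 < e / 2 by rewrite divr_gt0.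
apply: filterS2 (hf _ e20) (hg _ e20) => y fy gy.
by apply: opbound_le (opbound_add fy gy); lra.
Qed.

Lemma norm_null_mul F {FF : Filter F} a g M : 0 <= M ->
  (\forall y \near F, opbound (a y) M) -> norm_null F g ->
  norm_null F (fun y v => a y (g y v)).
Proof.
move=> M0 aM hg e e0; have M1 : 0 < M + 1 by rewrite ltr_wpDl.
apply: filterS2 aM (hg (e / (M + 1)) (divr_gt0 e0 M1)) => y aMy gy.
apply: opbound_le (opbound_comp M0 aMy gy).
by rewrite mulrCA ger_pMr // ler_pdivrMr // mul1r lerDl.
Qed.

Lemma norm_null_lim F {FF : Filter F} g :
  (forall e, 0 < e -> exists2 g', norm_null F g' &
     \forall y \near F, opbound (fun v => g y v - g' y v) e) -> norm_null F g.
Proof.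
move=> h e e0; have e20 : 0 < e / 2 by rewrite divr_gt0.
have [g' g'0 gg'] := h _ e20.
apply: filterS2 gg' (g'0 _ e20) => y h1 h2.
have := opbound_add h1 h2; rewrite -splitr => h3 v.
by have := h3 v; rewrite subrK.
Qed.

(* Bounded strong convergence is uniform on totally bounded sets; hence the
   product of a strongly continuous family and an element of [C(D) (x) K] is
   norm continuous. *)
Lemma norm_null_strong F {FF : Filter F} a (a0 T : H -> H) M : 0 <= M ->
  (\forall y \near F, linear (a y)) -> (\forall y \near F, opbound (a y) M) ->
  linear a0 -> opbound a0 M ->
  (forall v e, 0 < e -> \forall y \near F, nrm (a y v - a0 v) <= e) ->
  linear T -> totally_bounded_op T ->
  norm_null F (fun y v => a y (T v) - a0 (T v)).
Proof.
move=> M0 lina aM lina0 a0M aa0 linT tbT e e0.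
have M1 : 0 < 2 * M + 2 by lra.
have e20 : 0 < e / 2 by rewrite divr_gt0.
(* Replacing [T v] by a net point costs at most [M] times this radius for each of [a y] and [a0],
   together at most [e / 2]; the other half is for the finitely many net points. *)
have [s sP] := tbT (e / 2 / (2 * M + 2)) (divr_gt0 e20 M1).
have aa := @near_seq _ F FF s _ (fun w => aa0 w _ e20).
apply: filterS3 lina aM aa => y linay aMy has.
apply: opbound_unit (ltW e0) _.
  move=> c u v /=; rewrite linT linay lina0 scalerBr opprD -!addrA.
  by congr (_ + _); rewrite addrCA.
move=> v /sP[w ws]; rewrite ler_pdivlMr // => Tw.
have -> : a y (T v) - a0 (T v) = a y (T v - w) + (a y w - a0 w) - a0 (T v - w).
  by rewrite (linopB linay) (linopB lina0); vec.
have h1 := aMy (T v - w); have h2 := a0M (T v - w); have h3 := has w ws.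
have h4 := ler_nrmB (a y (T v - w) + (a y w - a0 w)) (a0 (T v - w)).
have h5 := ler_nrmD (a y (T v - w)) (a y w - a0 w).
have := nrm_ge0 (T v - w); lra.
Qed.

Lemma C0K_eq D f g : (forall x, D x -> f x = g x) -> C0K D f -> C0K D g.
Proof.
move=> fg /C0KP[cf nf pf mf]; apply/C0KP; split.
- by move=> x Dx; rewrite -fg //; exact: cf.
- move=> x Dx e e0; apply: withinS (nf x Dx e e0) => y Dy; by rewrite !fg.
- by move=> e e0; apply: withinS (pf e e0) => y Dy; rewrite fg.
- by move=> e e0; apply: withinS (mf e e0) => y Dy; rewrite fg.
Qed.

Lemma norm_null_subset F {FF : Filter F} D D' g : D' `<=` D ->
  norm_null (within D F) g -> norm_null (within D' F) g.
Proof.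
move=> DD hg e e0.
by apply: (@filterS _ F FF _ _ _ (hg e e0)) => y h /DD; exact: h.
Qed.

Lemma C0K_subset D D' g : D' `<=` D -> C0K D g -> C0K D' g.
Proof.
move=> DD /C0KP[cg ng pg mg]; apply/C0KP; split.
- by move=> x /DD; exact: cg.
- by move=> x /DD Dx; apply: norm_null_subset (ng x Dx).
- exact: norm_null_subset pg.
- exact: norm_null_subset mg.
Qed.

Lemma C0K_add D f g : C0K D f -> C0K D g -> C0K D (fun x v => f x v + g x v).
Proof.
move=> /C0KP[cf nf pf mf] /C0KP[cg ng pg mg]; apply/C0KP; split.
- by move=> x Dx; apply: compact_op_add; [exact: cf|exact: cg].
- by move=> x Dx; apply: norm_null_eq (norm_null_add (nf x Dx) (ng x Dx)) => y v; vec.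
- exact: norm_null_add.
- exact: norm_null_add.
Qed.

(** [a y k y - a x k x = a y (k y - k x) + (a y - a x) k x]: norm continuity of [k] handles the
    first term, compactness of [k x] the second through [norm_null_strong]. Products with the
    strongly continuous factor on the right are reached by [C0K_adj]. *)
Lemma C0K_mul D a k M : 0 <= M ->
  (forall x, D x -> linear (a x) /\ opbound (a x) M) ->
  strong_continuous D a -> C0K D k -> C0K D (fun x v => a x (k x v)).
Proof.
move=> M0 ha sa /C0KP[ck nk pk mk].
have aM F (FF : Filter F) : \forall y \near within D F, opbound (a y) M.
  by apply: withinT => y /ha[].
have la F (FF : Filter F) : \forall y \near within D F, linear (a y).
  by apply: withinT => y /ha[].
apply/C0KP; split; [|move=> x Dx|exact: norm_null_mul M0 (aM _ _) pk
  |exact: norm_null_mul M0 (aM _ _) mk].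
  move=> x Dx; apply: compact_op_compl; first exact: ck.
  by apply/bounded_opP; have [l b] := ha x Dx; split=> //; exists M.
have h1 : norm_null (within D (nbhs x)) (fun y v => a y (k y v - k x v)).
  exact: norm_null_mul M0 (aM _ _) (nk x Dx).
have [lax bax] := ha x Dx; have [bk tk] := (compact_opP _).1 (ck x Dx).
have h2 : norm_null (within D (nbhs x)) (fun y v => a y (k x v) - a x (k x v)).
  exact: norm_null_strong M0 (la _ _) (aM _ _) lax bax
    (fun v e => sa x v e Dx) bk.1 tk.
move=> e e0; apply: withinS (norm_null_add h1 h2 e0) => y Dy h v.
have := h v; rewrite (linopB (ha y Dy).1); congr (nrm _ <= _); vec.
Qed.

Lemma strong_continuous_cst D T : strong_continuous D (fun=> T).
Proof. by move=> x v e Dx e0; apply: nearW => y; rewrite subrr nrm0 ltW. Qed.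

Lemma C0K_scale D t k : C0K D k -> C0K D (fun x v => t%:C *: k x v).
Proof.
apply: (@C0K_mul D (fun _ v => t%:C *: v) k `|t|) => //.
  move=> x _; split; last by move=> v; rewrite nrmZ.
  exact: (linear_scale t (bounded_op_id H).1).
exact: strong_continuous_cst.
Qed.

Lemma C0K_adj D k k' : (forall x, D x -> isadj (k x) (k' x)) ->
  (forall x, D x -> compact_op (k' x)) -> C0K D k -> C0K D k'.
Proof.
move=> adjk ck' /C0KP[ck nk pk mk]; apply/C0KP; split=> //.
- move=> x Dx e e0; apply: withinS (nk x Dx e e0) => y Dy.
  apply: isadj_opbound (ltW e0) _ => u v.
  by rewrite !ipE (adjk x Dx) (adjk y Dy).
- move=> e e0; apply: withinS (pk e e0) => y Dy.
  by apply: isadj_opbound (ltW e0) _; exact: adjk.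
- move=> e e0; apply: withinS (mk e e0) => y Dy.
  by apply: isadj_opbound (ltW e0) _; exact: adjk.
Qed.

Lemma opbound_sub T S M N : opbound T M -> opbound S N ->
  opbound (fun v => T v - S v) (M + N).
Proof.
move=> TM SN v; apply: le_trans (ler_nrmB _ _) _.
by rewrite mulrDl lerD.
Qed.

Lemma C0K_lim D k : (forall x, D x -> linear (k x)) ->
  (forall e, 0 < e -> exists2 k', C0K D k' &
     forall x, D x -> opbound (fun v => k x v - k' x v) e) -> C0K D k.
Proof.
move=> link h; apply/C0KP; split.
- move=> x Dx; apply: compact_op_lim; first exact: link.
  by move=> e /h[k' [ck' _ _] kk']; exists (k' x); [exact: ck'|exact: kk'].
- move=> x Dx; apply: norm_null_lim => e e0.
  have [k' /C0KP[ck' nk' _ _] kk'] := h _ (divr_gt0 e0 (ltr0Sn _ 1)).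
  exists (fun y v => k' y v - k' x v); first exact: nk'.
  apply: withinT => y Dy; have := opbound_sub (kk' y Dy) (kk' x Dx).
  by rewrite -splitr; congr opbound; apply/funext => v; vec.
- apply: norm_null_lim => e /h[k' /C0KP[_ _ pk' _] kk'].
  by exists k' => //; exact: withinT.
- apply: norm_null_lim => e /h[k' /C0KP[_ _ _ mk'] kk'].
  by exists k' => //; exact: withinT.
Qed.

Lemma C0K_strong_continuous D k : C0K D k -> strong_continuous D k.
Proof.
move=> /C0KP[_ nk _ _] x v e Dx e0.
have v1 : 0 < nrm v + 1 by rewrite ltr_wpDl ?nrm_ge0.
apply: withinS (nk x Dx _ (divr_gt0 e0 v1)) => y Dy hy.
apply: le_trans (hy v) _; rewrite mulrAC -mulrA ger_pMr //.
by rewrite ler_pdivrMr // mul1r lerDl.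
Qed.

Lemma strong_continuous_add D f g : strong_continuous D f ->
  strong_continuous D g -> strong_continuous D (fun x v => f x v + g x v).
Proof.
move=> hf hg x v e Dx e0; have e20 : 0 < e / 2 by rewrite divr_gt0.
apply: withinS2 (hf x v _ Dx e20) (hg x v _ Dx e20) => y Dy h1 h2.
have -> : f y v + g y v - (f x v + g x v) = (f y v - f x v) + (g y v - g x v).
  by vec.
by apply: le_trans (ler_nrmD _ _) _; lra.
Qed.

Lemma strong_continuous_comp D f g M : 0 <= M ->
  (forall x, D x -> linear (f x) /\ opbound (f x) M) -> strong_continuous D f ->
  strong_continuous D g -> strong_continuous D (fun x v => f x (g x v)).
Proof.
move=> M0 fM hf hg x v e Dx e0; have e20 : 0 < e / 2 by rewrite divr_gt0.
have M1 : 0 < M + 1 by rewrite ltr_wpDl.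
apply: withinS2 (hf x (g x v) _ Dx e20) (hg x v _ Dx (divr_gt0 e20 M1)) => y Dy h1.
rewrite ler_pdivlMr // => h2.
have -> : f y (g y v) - f x (g x v) =
    f y (g y v - g x v) + (f y (g x v) - f x (g x v)).
  by rewrite (linopB (fM y Dy).1); vec.
 have h3 := (fM y Dy).2 (g y v - g x v).
apply: le_trans (ler_nrmD _ _) _.
have := nrm_ge0 (g y v - g x v); nra.
Qed.

Lemma strong_continuous_scale D t g :
  strong_continuous D g -> strong_continuous D (fun x v => t%:C *: g x v).
Proof.
apply: (@strong_continuous_comp D (fun _ v => t%:C *: v) g `|t|) => //.
  move=> x _; split; last by move=> v; rewrite nrmZ.
  exact: (linear_scale t (bounded_op_id H).1).
exact: strong_continuous_cst.
Qed.

Lemma strong_continuous_subset D D' f : D' `<=` D ->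
  strong_continuous D f -> strong_continuous D' f.
Proof.
move=> DD hf x v e Dx e0.
by apply: (@filterS _ (nbhs x) _ _ _ _ (hf x v e (DD _ Dx) e0)) => y h /DD; exact: h.
Qed.

Lemma strong_continuousP D f :
  (forall v, {within D, continuous (fun x => f x v)}) <-> strong_continuous D f.
Proof.
split=> [h x v e Dx e0|h v].
  have /subspace_continuousP/(_ x Dx)/cvg_nrmP := h v; exact.
by apply/subspace_continuousP => x Dx; apply/cvg_nrmP => e e0; exact: h.
Qed.

End Families.

(** * The Newton-Schulz iteration *)

Section NewtonSchulz.
Variables (R : realType) (H : hilbertType R).
Implicit Types (u v w : H) (t e M q : R) (T S : H -> H) (D : set R).

Definition defect T v := v - T (T v).
(** The inverse-free Newton step [T (3 - T^2) / 2] for the equation [T^2 = 1]. *)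
Definition schulz T v := (3 / 2)%:C *: T v - (1 / 2)%:C *: T (T (T v)).

Lemma linear_defect T : linear T -> linear (defect T).
Proof.
move=> linT a u v; rewrite /= /defect !linT scalerBr opprD -!addrA.
by congr (_ + _); rewrite addrCA.
Qed.

Lemma linear_schulz T : linear T -> linear (schulz T).
Proof.
move=> linT a u v; rewrite /= /schulz !linT !scalerDr !scalerN !scalerA.
rewrite ![a * _]mulrC opprD -!addrA; congr (_ + _).
by rewrite addrCA.
Qed.

Lemma isadj_schulz T : isadj T T -> isadj (schulz T) (schulz T).
Proof. by move=> aT u v; rewrite /schulz !ipE !aT. Qed.

Lemma schulzE T v : linear T -> schulz T v = T v + (1 / 2)%:C *: T (defect T v).
Proof. by move=> linT; rewrite /schulz /defect (linopB linT); vec. Qed.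

(** With [d = 1 - t^2], the step sends [t] to [t (1 + d/2)], and [(1 - d) (1 + d/2)^2 = 1 - 3/4 d^2
    - 1/4 d^3]. *)
Lemma defect_schulz T v : linear T -> defect (schulz T) v =
  (3 / 4)%:C *: defect T (defect T v) +
  (1 / 4)%:C *: defect T (defect T (defect T v)).
Proof.
move=> linT; rewrite /defect /schulz.
by do !rewrite ?(linopB linT) ?(linopZ linT); vec.
Qed.

(** [|T v|^2 = ip (v - defect T v) v <= 3/2 |v|^2], rounded up to [4 |v|^2]. *)
Lemma defect_opbound T : isadj T T -> opbound (defect T) (1 / 2) -> opbound T 2.
Proof.
move=> aT dT v; rewrite -(@ler_pXn2r _ 2) ?nnegrE ?mulr_ge0 ?nrm_ge0 //.
rewrite -ipvv -aT exprMn.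
have -> : T (T v) = v - defect T v by rewrite /defect; vec.
rewrite ipDl ipNl ipvv.
have h := ip_le (- defect T v) v; rewrite ipNl nrmN in h.
have h2 := dT v; have h3 := nrm_ge0 v; nra.
Qed.

(** For [q <= 1/2], [3/4 q^2 + 1/4 q^3 <= 7/16 q]. Halving is weaker than the quadratic convergence
    available, but gives a geometric rate. *)
Lemma opbound_defect_schulz T q : linear T -> 0 <= q -> q <= 1 / 2 ->
  opbound (defect T) q -> opbound (defect (schulz T)) (q / 2).
Proof.
move=> linT q0 q2 dT v; rewrite defect_schulz //.
apply: le_trans (ler_nrmD _ _) _; rewrite !nrmZ !ger0_norm; try lra.
have d2 := opbound_comp q0 dT dT; have d3 := opbound_comp q0 dT d2.
have := d2 v; have := d3 v => /= h3 h2.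
have h0 := nrm_ge0 v.
have hq : q * q <= q / 2 by nra.
have hq3 : q * (q * q) <= q / 4 by nra.
have i2 : nrm (defect T (defect T v)) <= q / 2 * nrm v.
  by apply: le_trans h2 _; rewrite ler_wpM2r.
have i3 : nrm (defect T (defect T (defect T v))) <= q / 4 * nrm v.
  by apply: le_trans h3 _; rewrite ler_wpM2r.
have : 0 <= q * nrm v by rewrite mulr_ge0.
lra.
Qed.

Lemma le_geometric (x K : R) : 0 <= K -> (forall n, x <= K * (1 / 2) ^+ n) -> x <= 0.
Proof.
move=> K0 h; apply: (ler_mul_small K0) => d d0 _.
have [|n _ hn] := (@cvgrPdist_le _ _ _ _ _ _ _).1 (@cvg_expr R (1 / 2) _) d d0.
  by rewrite ger0_norm; lra.
apply: le_trans (h n) _; rewrite ler_wpM2l //.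
have := hn n (leqnn n); rewrite sub0r normrN; apply: le_trans.
exact: ler_norm.
Qed.

(** The step from [Y n] adds half of [Y n] times its defect, of norm at most [1/2 * 2 * h^(n+1)], so
    [Y n v] is Cauchy for every [v]. The rate is the same for all admissible [T], which makes
    convergence uniform in a family. *)
Lemma schulz_limit T : linear T -> isadj T T -> opbound (defect T) (1 / 2) ->
  exists L, [/\ linear L, isadj L L, forall v, L (L v) = v &
    forall n, opbound (fun v => L v - iter n schulz T v) (2 * (1 / 2) ^+ n)].
Proof.
move=> linT aT dT; pose Y n := iter n schulz T; pose h : R := 1 / 2.
have h0 n : 0 <= h ^+ n by rewrite exprn_ge0 // /h; lra.
have YP n : [/\ linear (Y n), isadj (Y n) (Y n), opbound (defect (Y n)) (h ^+ n.+1)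
    & h ^+ n.+1 <= 1 / 2].
  elim: n => [|n [lY aY dY hn]]; first by split=> //; rewrite expr1 /h.
  split; [exact: linear_schulz|exact: isadj_schulz| |].
    have -> : h ^+ n.+2 = h ^+ n.+1 / 2 by rewrite exprSr /h; field.
    exact: opbound_defect_schulz.
  by rewrite exprS; have := h0 n.+1; rewrite /h; lra.
have Y2 n : opbound (Y n) 2.
  have [_ aY dY hn] := YP n; apply: defect_opbound => //.
  exact: opbound_le dY.
have Ystep n v : nrm (Y n.+1 v - Y n v) <= h ^+ n.+1 * nrm v.
  have [lY aY dY hn] := YP n; rewrite /Y iterS -/(Y n) schulzE // addrC addKr.
  rewrite nrmZ ger0_norm; last lra.
  by have := Y2 n (defect (Y n) v); have := dY v; lra.
(* Since [h = 1/2], the increments [h^(n+1)], ..., [h^(n+m)] sum to [h^n (1 - h^m)]. *)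
have Ydist n m v : nrm (Y (n + m)%N v - Y n v) <= h ^+ n * (1 - h ^+ m) * nrm v.
  elim: m => [|m IH]; first by rewrite addn0 subrr nrm0 expr0 subrr mulr0 mul0r.
  have -> : Y (n + m.+1)%N v - Y n v =
      (Y (n + m).+1 v - Y (n + m)%N v) + (Y (n + m)%N v - Y n v).
    by rewrite addnS; vec.
  apply: le_trans (ler_nrmD _ _) _; apply: le_trans (lerD (Ystep _ _) IH) _.
  rewrite !exprS exprD /h; lra.
have Ycauchy n m v : nrm (Y (n + m)%N v - Y n v) <= h ^+ n * nrm v.
  apply: le_trans (Ydist n m v) _; rewrite ler_wpM2r ?nrm_ge0 //.
  by rewrite ler_piMr // lerBlDr lerDl.
have small e : 0 < e -> exists N, forall n, (N <= n)%N -> h ^+ n <= e.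
  move=> e0.
  have [|N _ hN] := (@cvgrPdist_le _ _ _ _ _ _ _).1 (@cvg_expr R h _) e e0.
    by rewrite /h ger0_norm; lra.
  exists N => n Nn; have := hN n Nn; rewrite sub0r normrN.
  exact: le_trans (ler_norm _).
have /choice[L LP] : forall v, exists l : H, Y n v @[n --> \oo] --> l.
  move=> v; apply: nrm_complete => e e0.
  have v1 : 0 < 2 * (nrm v + 1) by have := nrm_ge0 v; lra.
  have [N hN] := small _ (divr_gt0 e0 v1); exists N => m n Nm Nn.
  have {hN} := hN N (leqnn N); rewrite ler_pdivlMr // => hN.
  have -> : Y m v - Y n v = (Y m v - Y N v) - (Y n v - Y N v) by vec.
  apply: le_trans (ler_nrmB _ _) _.
  have := Ycauchy N (m - N)%N v; have := Ycauchy N (n - N)%N v.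
  by rewrite !subnKC //; have := h0 N; lra.
have Ldist n v : nrm (L v - Y n v) <= h ^+ n * nrm v.
  apply/ler_addgt0Pr => e e0.
  have /cvg_nrmP/(_ _ e0)[N _ hN] := LP v.
  have {hN} := hN (n + N)%N (leq_addl _ _) => hN.
  have -> : L v - Y n v = (Y (n + N)%N v - Y n v) - (Y (n + N)%N v - L v) by vec.
  by apply: le_trans (ler_nrmB _ _) _; have := Ycauchy n N v; lra.
exists L; split.
(* Each identity holds for [Y n], exactly or up to its defect; the error for [L] is at most a
   constant times [h^n], hence 0 by [le_geometric]. *)
- move=> a u v; apply/eqP; rewrite -subr_eq0; apply/eqP/nrm_eq0/eqP.
  rewrite eq_le nrm_ge0 andbT.
  apply: (@le_geometric _ (nrm (a *: u + v) + complex.Re `|a| * nrm u + nrm v)).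
    rewrite !addr_ge0 ?mulr_ge0 ?nrm_ge0 //.
    by rewrite -ler0c RRe_real // ger0_real.
  move=> n; have [lY _ _ _] := YP n.
  have -> : L (a *: u + v) - (a *: L u + L v) = (L (a *: u + v) - Y n (a *: u + v))
      - (a *: (L u - Y n u)) - (L v - Y n v).
    rewrite lY scalerBr; vec.
  apply: le_trans (ler_nrmB _ _) _.
  have i1 := ler_nrmB (L (a *: u + v) - Y n (a *: u + v)) (a *: (L u - Y n u)).
  have i2 : nrm (a *: (L u - Y n u)) = complex.Re `|a| * nrm (L u - Y n u).
    by apply: complexI; rewrite -normE normrZ rmorphM /= normE RRe_real // ger0_real.
  have i3 : 0 <= complex.Re `|a| by rewrite -ler0c RRe_real // ger0_real.
  have := Ldist n (a *: u + v); have := Ldist n u; have := Ldist n v.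
  rewrite -/h; nra.
- move=> u v; apply/eqP; rewrite -subr_eq0 -normr_eq0; apply/eqP.
  apply/eqP; rewrite eq_le normr_ge0 andbT.
  apply: (@le_geometric _ (2 * (nrm u * nrm v))).
    by rewrite !mulr_ge0 ?nrm_ge0.
  move=> n; have [_ aY _ _] := YP n.
  have -> : ip (L u) v - ip u (L v) = ip (L u - Y n u) v - ip u (L v - Y n v).
    by rewrite !ipE aY; ring.
  have i1 := Ldist n u; have i2 := Ldist n v.
  have j1 := ip_le (L u - Y n u) v; have j2 := ip_le (- (L u - Y n u)) v.
  have j3 := ip_le u (L v - Y n v); have j4 := ip_le u (- (L v - Y n v)).
  rewrite ipNl nrmN in j2; rewrite ipNr nrmN in j4.
  have u0 := nrm_ge0 u; have v0 := nrm_ge0 v.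
  have k1 : nrm (L u - Y n u) * nrm v <= h ^+ n * nrm u * nrm v.
    by rewrite ler_wpM2r.
  have k2 : nrm u * nrm (L v - Y n v) <= nrm u * (h ^+ n * nrm v).
    by rewrite ler_wpM2l.
  rewrite -/h ler_norml; lra.
- move=> v; apply/eqP; rewrite -subr_eq0; apply/eqP/nrm_eq0/eqP.
  rewrite eq_le nrm_ge0 andbT.
  apply: (@le_geometric _ (nrm v + 2 * nrm v + nrm (L v))).
    by rewrite !addr_ge0 ?mulr_ge0 ?nrm_ge0.
  move=> n; have [lY _ dY hn] := YP n.
  have -> : L (L v) - v = (L (L v) - Y n (L v)) + Y n (L v - Y n v)
      - defect (Y n) v.
    by rewrite /defect (linopB lY); vec.
  apply: le_trans (ler_nrmB _ _) _.
  have i1 := ler_nrmD (L (L v) - Y n (L v)) (Y n (L v - Y n v)).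
  have := Ldist n (L v); have := Ldist n v; have := Y2 n (L v - Y n v).
  have hE : h * h ^+ n = h ^+ n / 2 by rewrite {1}/h; field.
  have := dY v; rewrite exprS hE -/h.
  have : 0 <= h ^+ n * nrm v by rewrite mulr_ge0 ?nrm_ge0.
  lra.
- move=> n v; apply: le_trans (Ldist n v) _.
  by rewrite ler_wpM2r ?nrm_ge0 // -/h; have := h0 n; lra.
Qed.

(** The limit may be chosen separately at each [x]: the rate in [schulz_limit] does not depend on
    [x], so [y - y0] is a uniform limit of the [C0K] families [Y n - y0], and continuity follows. *)
Lemma symmetry_family D (y0 : R -> H -> H) :
  (forall x, D x -> linear (y0 x) /\ isadj (y0 x) (y0 x)) ->
  strong_continuous D y0 -> C0K D (fun x => defect (y0 x)) ->
  (forall x, D x -> opbound (defect (y0 x)) (1 / 2)) ->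
  exists y, (forall x, D x ->
      [/\ linear (y x), isadj (y x) (y x) & forall v, y x (y x v) = v]) /\
    C0K D (fun x v => y x v - y0 x v).
Proof.
move=> hy0 sy0 cy0 dy0.
have /choice[y yP] : forall x, exists L, D x ->
    [/\ linear L, isadj L L, forall v, L (L v) = v &
    forall n, opbound (fun v => L v - iter n schulz (y0 x) v) (2 * (1 / 2) ^+ n)].
  move=> x; have [Dx|Dx] := pselect (D x); last by exists id.
  have [lx ax] := hy0 x Dx.
  by have [L LP] := schulz_limit lx ax (dy0 x Dx); exists L.
exists y; split=> [x /yP[]//|].
pose Y n x := iter n schulz (y0 x).
have YP n : [/\ forall x, D x ->
      [/\ linear (Y n x), isadj (Y n x) (Y n x) & opbound (defect (Y n x)) (1 / 2)],
    strong_continuous D (Y n), C0K D (fun x => defect (Y n x)) &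
    C0K D (fun x v => Y n x v - y0 x v)].
  elim: n => [|n [hY sY cY dY]].
    split=> //; first by move=> x Dx; split; [case: (hy0 x Dx)..|exact: dy0].
    apply: C0K_eq (C0K_scale 0 cy0) => x Dx; apply: funext => v.
    by rewrite scale0r subrr.
  have Y2 x : D x -> linear (Y n x) /\ opbound (Y n x) 2.
    by case/hY => lY aY d; split=> //; exact: defect_opbound.
  have dd x : D x -> linear (defect (Y n x)) /\ opbound (defect (Y n x)) (1 / 2).
    by case/hY => lY aY d; split=> //; exact: linear_defect.
  have sd := C0K_strong_continuous cY.
  have cYd : C0K D (fun x v => (1 / 2)%:C *: Y n x (defect (Y n x) v)).
    by apply: C0K_scale; apply: C0K_mul Y2 sY cY.
  have YE x v : D x -> Y n.+1 x v = Y n x v + (1 / 2)%:C *: Y n x (defect (Y n x) v).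
    by case/hY => lY _ _; rewrite /Y iterS -/(Y n x) schulzE.
  have cY' : C0K D (fun x v => Y n.+1 x v - y0 x v).
    apply: C0K_eq (C0K_add dY cYd) => x Dx; apply/funext => v.
    by rewrite YE //; vec.
  split=> //.
  - move=> x /hY[lY aY d]; rewrite /Y iterS -/(Y n x).
    split; [exact: linear_schulz|exact: isadj_schulz|].
    by apply: opbound_le (opbound_defect_schulz lY _ _ d); lra.
  - have : strong_continuous D (fun x v => (Y n.+1 x v - y0 x v) + y0 x v).
      exact: strong_continuous_add (C0K_strong_continuous cY') sy0.
    by congr strong_continuous; apply/funext => x; apply/funext => v; rewrite subrK.
  - have h12 : 0 <= 1 / 2 :> R by lra.
    have c2 := C0K_mul h12 dd sd cY; have c3 := C0K_mul h12 dd sd c2.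
    apply: C0K_eq (C0K_add (C0K_scale (3 / 4) c2) (C0K_scale (1 / 4) c3)) => x Dx.
    apply/funext => v; have [lY _ _] := hY x Dx.
    by rewrite /Y iterS -/(Y n x) defect_schulz.
apply: C0K_lim => [x Dx|e e0].
  have [ly _ _ _] := yP x Dx; have [l0 _] := hy0 x Dx => a u v.
  by rewrite /= ly l0 scalerBr opprD addrACA.
have e20 : 0 < e / 2 by rewrite divr_gt0.
have [|N _ hN] := (@cvgrPdist_le _ _ _ _ _ _ _).1 (@cvg_expr R (1 / 2) _) _ e20.
  by rewrite ger0_norm; lra.
have {hN} := hN N (leqnn N); rewrite sub0r normrN => hN.
have [_ _ _ cN] := YP N; exists (fun x v => Y N x v - y0 x v) => // x Dx v.
have [_ _ _ /(_ N v)] := yP x Dx.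
rewrite (_ : y x v - y0 x v - _ = y x v - Y N x v); last by vec.
move=> /le_trans; apply; rewrite ler_wpM2r ?nrm_ge0 //.
by have := ler_norm ((1 / 2 : R) ^+ N); lra.
Qed.

End NewtonSchulz.

(** * Lifting projections locally *)

Section LocalLift.
Variables (R : realType) (H : hilbertType R).
Implicit Types (u v w : H) (t e M : R) (T S : H -> H) (D : set R) (X : base).
Implicit Types (f g p k : R -> H -> H).

Lemma C0K0 D : C0K D (fun _ _ => 0 : H).
Proof.
have n0 F : Filter F -> norm_null F (fun _ _ => 0 : H).
  move=> FF e e0; apply: nearW => y v.
  by rewrite nrm0 mulr_ge0 ?nrm_ge0 // ltW.
apply/C0KP; split=> [x _|x _||]; [exact: compact_op0| |exact: n0|exact: n0].
by apply: norm_null_eq (n0 _ _) => y v; rewrite subrr.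
Qed.

Lemma C0K_sub D f g : C0K D f -> C0K D g -> C0K D (fun x v => f x v - g x v).
Proof.
move=> cf cg; apply: C0K_eq (C0K_add cf (C0K_scale (-1) cg)) => x _.
by apply/funext => v; vec.
Qed.

Lemma strong_continuous_eq D f g : (forall x, D x -> f x = g x) ->
  strong_continuous D f -> strong_continuous D g.
Proof.
move=> fg hf x v e Dx e0; apply: withinS (hf x v e Dx e0) => y Dy.
by rewrite !fg.
Qed.

Lemma CbB_selfadjoint D f M : 0 <= M ->
  (forall x, D x -> [/\ linear (f x), isadj (f x) (f x) & opbound (f x) M]) ->
  strong_continuous D f -> CbB D f.
Proof.
move=> M0 hf sf; split=> [x /hf[l a b]||v].
- by apply/bounded_opP; split=> //; exists M.
- by exists M => x /hf[l a b]; exact: opnorm_le.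
- split; first exact: (strong_continuousP D f).2 sf v.
  apply: (strong_continuousP D (fun x => adj (f x))).2 v.
  by apply: strong_continuous_eq sf => x /hf[l a b]; rewrite (adjE l a).
Qed.

Lemma CbB_strong_continuous D f : CbB D f -> strong_continuous D f.
Proof. by move=> [_ _ sf]; apply/strong_continuousP => v; case: (sf v). Qed.

Lemma CbB_bound D f : CbB D f ->
  exists2 M, 0 <= M & forall x, D x -> linear (f x) /\ opbound (f x) M.
Proof.
move=> [bf [M fM] _]; exists `|M| => // x Dx; split; first by case: (bf x Dx).
apply: opbound_le (opboundP (bf x Dx)).
exact: le_trans (fM x Dx) (ler_norm M).
Qed.

Lemma CbB_adj D f : CbB D f -> CbB D (fun x => adj (f x)).
Proof.
move=> cf; have [M M0 fM] := CbB_bound cf; case: cf => bf _ sf.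
have af x (Dx : D x) := isadj_adj (bf x Dx).
split=> [x Dx||v].
- exact: isadj_bounded (bf x Dx) (af x Dx).
- exists M => x Dx; apply: opnorm_le => //.
  exact: isadj_opbound M0 (af x Dx) (fM x Dx).2.
- split; first by case: (sf v).
  apply: (strong_continuousP D (fun x => adj (adj (f x)))).2 v.
  apply: (@strong_continuous_eq D f).
    move=> x Dx; rewrite (@adjE _ _ (adj (f x)) (f x)) //.
      exact: (isadj_linear (bf x Dx).1 (af x Dx)).
    exact: isadj_sym (af x Dx).
  by apply/strong_continuousP => w; case: (sf w).
Qed.

Lemma selfadjoint_lift X (F : set (R -> H -> H)) : corona_projection X F ->
  exists f, [/\ multI X f, forall x, carrier R X x -> isadj (f x) (f x),
    F = [set g | multI X g /\ C0K (carrier R X) (fun x v => g x v - f x v)] &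
    C0K (carrier R X) (fun x v => f x (f x v) - f x v)].
Proof.
move=> [[f0 mf0 F0] FF Fadj]; set D := carrier R X.
have ideal g g' : multI X g -> multI X g' -> C0K D (g - g') -> idealI X (g - g').
  move=> [_ dg] [_ dg'] cg; split=> // Xc.
  by change (g 0 - g' 0 = g 1 - g' 1); rewrite dg // dg'.
have refl g : multI X g -> coset X g g.
  move=> mg; split=> //; apply: ideal => //.
  apply: C0K_eq (C0K0 D) => x _; apply: funext => v.
  by rewrite -[RHS]/(g x v - g x v) subrr.
have mh : multI X (fun x => adj (f0 x)).
  by split; [exact: CbB_adj mf0.1|move=> /mf0.2 ->].
have : F (fun x => adj (f0 x)).
  by rewrite -Fadj; exists f0; [rewrite F0; exact: refl|exact: refl].
rewrite F0 => -[_ [ch _]].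
have [M M0 fM] := CbB_bound mf0.1.
have [bf0 _ _] := mf0.1.
have af x (Dx : D x) := isadj_adj (bf0 x Dx).
pose f x v := (1 / 2)%:C *: (f0 x v + adj (f0 x) v).
have fP x : D x -> [/\ linear (f x), isadj (f x) (f x) & opbound (f x) M].
  move=> Dx; split.
  - apply: linear_scale; apply: linear_add; first exact: (bf0 x Dx).1.
    by apply: isadj_linear (af x Dx); exact: (bf0 x Dx).1.
  - by move=> u v; rewrite /f !ipE (af x Dx) (isadj_sym (af x Dx)) addrC.
  - have := opbound_scale (1 / 2) (opbound_add (fM x Dx).2
      (isadj_opbound M0 (af x Dx) (fM x Dx).2)).
    by apply: opbound_le; rewrite ger0_norm; lra.
have sf : strong_continuous D f.
  apply: strong_continuous_scale; apply: strong_continuous_add.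
    exact: CbB_strong_continuous mf0.1.
  exact: CbB_strong_continuous mh.1.
have df : descends X f by move=> Xc; rewrite /f (mf0.2 Xc).
have mf : multI X f by split=> //; exact: (CbB_selfadjoint M0 fP sf).
have cff0 : C0K D (fun x v => f x v - f0 x v).
  apply: C0K_eq (C0K_scale (1 / 2) ch) => x _; apply/funext => v.
  rewrite -[(_ - _) x v]/(adj (f0 x) v - f0 x v) /f; vec.
have Ff : F f by rewrite F0; split=> //; exact: ideal.
have mff : multI X (fun x v => f x (f x v)).
  split; last by move=> /df ->.
  apply: (@CbB_selfadjoint _ _ (M * M)); first exact: mulr_ge0.
    move=> x /fP[l a b]; split; [exact: linear_comp|by move=> u v; rewrite !a|].
    exact: opbound_comp.
  by apply: (@strong_continuous_comp _ _ D f f M) => // x /fP[].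
have : F (fun x v => f x (f x v)).
  by rewrite -FF; exists f, f; split=> //; exact: refl.
rewrite F0 => -[_ [cff _]].
exists f; split=> //.
- by move=> x /fP[].
- apply/seteqP; split=> [g [mg [cg _]]|g [mg cg]]; split=> //.
    by apply: C0K_eq (C0K_sub cg cff0) => x _; apply/funext => v;
      rewrite -[(_ - _) x v]/(g x v - f0 x v); vec.
  apply: ideal => //.
  apply: C0K_eq (C0K_add cg cff0) => x _; apply/funext => v.
  rewrite -[RHS]/(g x v - f0 x v); vec.
- apply: C0K_eq (C0K_sub cff cff0) => x _; apply/funext => v.
  rewrite -[(_ - _) x v]/(f x (f x v) - f0 x v); vec.
Qed.

(** Continuity of [p] is left out: congruence to a strongly continuous [f] provides it
    ([projection_lift_CbB]). The property is inherited by subsets of [D], as covering arguments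
    need. *)
Definition projection_lift D f := exists p,
  (forall x, D x -> projection_op (p x)) /\ C0K D (fun x v => p x v - f x v).

Lemma projection_lift_subset D D' f : D' `<=` D ->
  projection_lift D f -> projection_lift D' f.
Proof.
move=> DD [p [pp cp]]; exists p; split; first by move=> x /DD; exact: pp.
exact: C0K_subset cp.
Qed.

Lemma projection_opP T : bounded_op T -> T \o T = T -> isadj T T -> projection_op T.
Proof. by move=> bT TT aT; split=> //; exact: (adjE bT.1 aT). Qed.

Lemma projection_lift_CbB D f p : strong_continuous D f ->
  (forall x, D x -> projection_op (p x)) -> C0K D (fun x v => p x v - f x v) ->
  CbB D p.
Proof.
move=> sf pp cp; apply: (@CbB_selfadjoint _ _ 1) => // [x /pp[bp ppx ap]|].
  have apx : isadj (p x) (p x) by have := isadj_adj bp; rewrite ap.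
  split=> //; first exact: bp.1.
  move=> v; rewrite mul1r; have [v0|v0] := eqVneq (nrm (p x v)) 0.
    by rewrite v0 nrm_ge0.
  rewrite -(@ler_pM2l _ (nrm (p x v))) ?lt_def ?v0 ?nrm_ge0 //.
  by rewrite -expr2 -ipvv -apx -[p x (p x v)]/((p x \o p x) v) ppx ip_le.
have := strong_continuous_add (C0K_strong_continuous cp) sf.
by apply: strong_continuous_eq => x _; apply/funext => v; rewrite subrK.
Qed.

(** * Local lifts of a self-adjoint family that is idempotent modulo compacts *)

Section SelfAdjoint.
Variables (D : set R) (f : R -> H -> H) (M : R).
Hypotheses (M0 : 0 <= M)
  (hf : forall x, D x -> [/\ linear (f x), isadj (f x) (f x) & opbound (f x) M])
  (sf : strong_continuous D f) (cf : C0K D (fun x v => f x (f x v) - f x v)).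

Let s x v := 2%:C *: f x v - v.

Let sP x : D x ->
  [/\ linear (s x), isadj (s x) (s x) & opbound (s x) (2 * M + 1)].
Proof.
move=> /hf[l a b]; split.
- move=> c u v; rewrite /s l scalerDr !scalerA scalerBr scalerA [_ * c]mulrC.
  by rewrite opprD addrACA.
- by move=> u v; rewrite /s !ipE a.
- move=> v; apply: le_trans (ler_nrmB _ _) _; rewrite nrmZ ger0_norm //.
  by have := b v; lra.
Qed.

Let ss : strong_continuous D s.
Proof.
have := strong_continuous_add (strong_continuous_scale 2 sf)
  (@strong_continuous_cst _ H D (fun v => (-1)%:C *: v)).
by apply: strong_continuous_eq => x _; apply/funext => v; rewrite /s; vec.
Qed.

(** [1 - (s + K)^2 = -4 (f^2 - f) - (s K + K s + K^2)]. Here [C0K_mul] covers [s K], and [K s] is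
    its adjoint. *)
Lemma defect_perturbation D' K : D' `<=` D -> compact_op K -> isadj K K ->
  C0K D' (fun=> K) -> C0K D' (fun x => defect (fun v => s x v + K v)).
Proof.
move=> DD cK aK cK'.
have M1 : 0 <= 2 * M + 1 by have := M0; lra.
have s' x : D' x -> linear (s x) /\ opbound (s x) (2 * M + 1).
  by move=> /DD /sP[].
have csK : C0K D' (fun x v => s x (K v)).
  apply: C0K_mul M1 s' _ cK'; exact: strong_continuous_subset ss.
have cKs : C0K D' (fun x v => K (s x v)).
  apply: C0K_adj csK => x Dx; first by have [_ a _] := sP (DD _ Dx) => u v; rewrite a aK.
  apply: compact_op_compr => //; apply/bounded_opP; have [l b] := s' x Dx.
  by split=> //; exists (2 * M + 1).
have [linK [N N0 KN]] := (bounded_opP K).1 cK.1.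
have cKK : C0K D' (fun x v => K (K v)).
  by apply: (@C0K_mul _ _ _ (fun=> K) (fun=> K) N) => //;
    exact: strong_continuous_cst.
have c1 := C0K_scale (- 4) (C0K_subset DD cf).
apply: C0K_eq (C0K_sub c1 (C0K_add csK (C0K_add cKs cKK))) => x Dx.
apply/funext => v; rewrite /defect.
have [l _ _] := hf (DD _ Dx); have [ls _ _] := sP (DD _ Dx).
have ssE : s x (s x v) = v + 4%:C *: (f x (f x v) - f x v).
  by rewrite /s (linopB l) (linopZ l); vec.
by rewrite (linopD ls) (linopD linK (s x v)) ssE; vec.
Qed.

(** For the symmetry [y] obtained from [s + K], the projection [(1 + y) / 2] differs from [f] by
    half of [(y - (s + K)) + K]. The condition on the constant family [K] can be met with [D']
    bounded or with [K = 0]. *)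
Lemma projection_lift_perturbation D' K : D' `<=` D -> compact_op K ->
  isadj K K -> C0K D' (fun=> K) ->
  (forall x, D' x -> opbound (defect (fun v => s x v + K v)) (1 / 2)) ->
  projection_lift D' f.
Proof.
move=> DD cK aK cK' dK.
have [|||y [yP cy]] := @symmetry_family _ _ D' (fun x v => s x v + K v) _ _ _ dK.
- move=> x /DD /sP[l a b]; split; first exact: linear_add l cK.1.1.
  by move=> u v; rewrite ipDl a aK -ipDr.
- apply: strong_continuous_add (C0K_strong_continuous cK').
  exact: strong_continuous_subset ss.
- exact: defect_perturbation.
exists (fun x v => (1 / 2)%:C *: (v + y x v)); split.
  move=> x /yP[l a yy].
  have linp : linear (fun v => (1 / 2)%:C *: (v + y x v)).
    by apply: linear_scale; apply: linear_add l; exact: (bounded_op_id H).1.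
  apply: projection_opP.
  - apply/bounded_opP; split=> //; exists 1 => // v.
    rewrite nrmZ ger0_norm; last lra.
    have := ler_nrmD v (y x v).
    have : nrm (y x v) = nrm v.
      apply/eqP; rewrite -(@eqrXn2 _ 2) ?nrm_ge0 // -!ipvv a yy //.
    by move=> ->; lra.
  - by apply/funext => v /=; rewrite (linopZ l) (linopD l) yy; vec.
  - by move=> u v; rewrite !ipE a.
apply: C0K_eq (C0K_scale (1 / 2) (C0K_add cy cK')) => x _.
by apply/funext => v; rewrite /s; vec.
Qed.

Lemma projection_lift_near x0 : D x0 -> exists2 e : R, 0 < e &
  projection_lift (D `&` [set t | `|t - x0| <= e]) f.
Proof.
move=> Dx0; have [ls as0 bs] := sP Dx0; have [l _ _] := hf Dx0.
have M1 : 0 <= 2 * M + 1 by have := M0; lra.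
have bS : bounded_op (s x0) by apply/bounded_opP; split=> //; exists (2 * M + 1).
have cS : compact_op (fun v => s x0 (s x0 v) - v).
  have /C0KP[/(_ x0 Dx0) + _ _ _] := C0K_scale 4 cf.
  congr compact_op; apply/funext => v.
  by rewrite /s (linopB l) (linopZ l); vec.
have q0 : 0 < 1 / 4 :> R by lra.
have [K [cK aK Kq]] := compact_perturbation_symmetry bS as0 cS q0.
(* A bounded window, so that the constant [K] satisfies the vanishing conditions at infinity
   vacuously. *)
pose D1 := D `&` [set t | `|t - x0| <= 1].
have D1D : D1 `<=` D by move=> t [].
have cK1 : C0K D1 (fun=> K).
  apply/C0KP; split=> // [x _|e e0|e e0].
  - move=> e e0; apply: nearW => y v.
    by rewrite subrr nrm0 mulr_ge0 ?nrm_ge0 // ltW.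
  - apply: (@filterS _ (pinfty_nbhs R) _ [set t | x0 + 1 < t]).
      move=> t /= xt [_ /=]; rewrite ler_norml => /andP[_ h]; lra.
    by apply: nbhs_pinfty_gt; exact: num_real.
  - apply: (@filterS _ (ninfty_nbhs R) _ [set t | t < x0 - 1]).
      move=> t /= xt [_ /=]; rewrite ler_norml => /andP[h _]; lra.
    by apply: nbhs_ninfty_lt; exact: num_real.
have cd := defect_perturbation D1D cK aK cK1.
have D1x0 : D1 x0 by split=> //=; rewrite subrr normr0.
have /C0KP[_ /(_ x0 D1x0) nd _ _] := cd.
have /nbhs_ballP[d /= d0 hd] := nd _ q0.
(* The bound 1 keeps the set inside [D1]; [d / 2] puts the closed interval inside the open ball of
   radius [d]. *)
exists (Num.min 1 (d / 2)); first by rewrite lt_min ltr01 divr_gt0.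
have sub : D `&` [set t | `|t - x0| <= Num.min 1 (d / 2)] `<=` D1.
  by move=> t [Dt /= ht]; split=> //=; rewrite (le_trans ht) // ge_min lexx.
apply: (@projection_lift_perturbation _ K) => //.
- exact: C0K_subset cK1.
- move=> t Dt; have D1t := sub t Dt.
  have bt : ball x0 d t.
    rewrite -ball_normE /= distrC; case: Dt => _ /=.
    rewrite le_min => /andP[_ h]; apply: le_lt_trans h _.
    by rewrite ltr_pdivrMr // ltr_pMr // ltr1n.
  move=> v; have h1 := hd t bt D1t v; have h2 := Kq v.
  have h3 : nrm (defect (fun v => s x0 v + K v) v) <= 1 / 4 * nrm v.
    by rewrite /defect nrm_distC; exact: h2.
  have {}h1 : nrm (defect (fun v => s t v + K v) v - defect (fun v => s x0 v + K v) v)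
      <= 1 / 4 * nrm v := h1.
  have := ler_nrmD (defect (fun v => s t v + K v) v - defect (fun v => s x0 v + K v) v)
    (defect (fun v => s x0 v + K v) v).
  by rewrite subrK; lra.
Qed.

Lemma projection_lift_small D' : D' `<=` D ->
  (forall t, D' t -> opbound (fun v => f t (f t v) - f t v) (1 / 8)) ->
  projection_lift D' f.
Proof.
move=> DD hD; apply: (@projection_lift_perturbation _ (fun=> 0)) => //.
- exact: compact_op0.
- by move=> u v; rewrite ip0l ip0r.
- exact: C0K0.
- move=> t Dt v; have [l _ _] := hf (DD t Dt).
  have -> : defect (fun w => s t w + 0) v = (- 4)%:C *: (f t (f t v) - f t v).
    by rewrite /defect /s !addr0 (linopB l) (linopZ l); vec.
  rewrite nrmZ normrN ger0_norm //; have := hD t Dt v; lra.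
Qed.

End SelfAdjoint.
End LocalLift.

(** * Partitions *)

Section Partition.
Variables (R : realType) (H : hilbertType R).
Implicit Types (D : set R) (X : base) (f g p k : R -> H -> H).

Lemma piece_cover X n (x : nat -> R) t : carrier R X t ->
  exists2 i, (i <= n)%N & piece X n x i t.
Proof.
move=> Xt; have : forall j, (j <= n)%N ->
    (exists2 i, (i <= n)%N & piece X n x i t) \/ ((0 < j)%N -> x j <= t).
  elim=> [|j IH] jn; first by right.
  have [|h] := IH (ltnW jn); first by left.
  have [tx|xt] := leP t (x j.+1); last by right=> _; exact: ltW.
  by left; exists j; [exact: ltnW|split].
move=> /(_ n (leqnn n))[//|h]; exists n => //; split=> //.
by rewrite ltnn.
Qed.

Lemma piece_sub X n (x : nat -> R) i : piece X n x i `<=` carrier R X.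
Proof. by move=> t []. Qed.

(** Inside the carrier, leaving a piece means violating one of its two weak inequalities, an open
    condition. When gluing at [t], the pieces that miss [t] can thus be ignored. *)
Lemma piece_nbhs X n (x : nat -> R) i t : carrier R X t -> ~ piece X n x i t ->
  \forall y \near t, ~ piece X n x i y.
Proof.
move=> Xt nit.
have [/andP[i0 ti]|h1] := boolP ((0 < i)%N && (t < x i)).
  have oi : open_nbhs t [set y | y < x i] by split=> //; exact: open_lt.
  apply: filterS (open_nbhs_nbhs oi) => y /= yi [_ /(_ i0)].
  by rewrite leNgt yi.
have [/andP[i0 ti]|h2] := boolP ((i < n)%N && (x i.+1 < t)).
  have oi : open_nbhs t [set y | x i.+1 < y] by split=> //; exact: open_gt.
  apply: filterS (open_nbhs_nbhs oi) => y /= yi [_ _ /(_ i0)].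
  by rewrite leNgt yi.
exfalso; apply: nit; split=> //.
  by move=> i0; move: h1; rewrite i0 /= -leNgt.
by move=> i0; move: h2; rewrite i0 /= -leNgt.
Qed.

Lemma C0K_piece X n (x : nat -> R) k :
  (forall i, (i <= n)%N -> C0K (piece X n x i) k) -> C0K (carrier R X) k.
Proof.
move=> ck.
have glue (F : set_system R) (FF : Filter F) k' :
    (forall i, (i <= n)%N -> norm_null (within (piece X n x i) F) k') ->
    norm_null (within (carrier R X) F) k'.
  move=> h e e0.
  have := @near_seq _ _ F FF (iota 0 n.+1)
    (fun i y => (i <= n)%N -> piece X n x i y -> opbound (k' y) e).
  move=> hn; apply: (@filterS _ F FF _ _ _ (hn _)).
    move=> y hy Xy; have [i i_n iy] := piece_cover n x Xy.
    by apply: (hy i) => //; rewrite mem_iota.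
  move=> i; have [i_n|ni] := boolP (i <= n)%N; last exact: nearW.
  by apply: (@filterS _ F FF _ _ _ (h i i_n e e0)) => y hy _; exact: hy.
apply/C0KP; split.
- move=> t /(piece_cover n x)[i i_n it].
  by have /C0KP[c _ _ _] := ck i i_n; exact: c.
- move=> t Xt; apply: glue => i i_n.
  have [it|nit] := pselect (piece X n x i t).
    by have /C0KP[_ + _ _] := ck i i_n; apply.
  move=> e e0; apply: (@filterS _ (nbhs t) _ _ _ _ (piece_nbhs Xt nit)).
  by move=> y ny iy; case: ny.
- by apply: glue => i i_n; have /C0KP[] := ck i i_n.
- by apply: glue => i i_n; have /C0KP[] := ck i i_n.
Qed.

(** All [p i] are compared with the one global [f]: at a division point both neighbours differ from
    the same [f (x i)] by a compact operator, and on the circle [f 0 = f 1]. The two cosets agree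
    since [g - p i = (g - f) - (p i - f)] on each piece and [C0K_piece] glues. *)
Lemma represents_lift X F f n (x : nat -> R) (p : nat -> R -> H -> H) :
  partition_points X n x -> multI X f ->
  F = [set g | multI X g /\ C0K (carrier R X) (fun y v => g y v - f y v)] ->
  (forall i, (i <= n)%N -> (forall t, piece X n x i t -> projection_op (p i t)) /\
     C0K (piece X n x i) (fun y v => p i y v - f y v)) ->
  represents X n x p F.
Proof.
move=> [n0 xI xlt] mf FE hp.
have sf := CbB_strong_continuous mf.1.
have xle i : (0 < i < n)%N -> x i <= x i.+1 by move=> /xlt/ltW.
have xX i : (0 < i <= n)%N -> carrier R X (x i).
  by move=> /xI; exact: interior_subset.
have x_left i : (0 < i <= n)%N -> piece X n x i (x i).
  by move=> hi; split=> //; [exact: xX|move=> i_n; apply: xle; case/andP: hi => -> _].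
have x_right i : (0 < i <= n)%N -> piece X n x i.-1 (x i).
  move=> hi; split; [exact: xX| |]; last by case: i hi.
  by case: i hi => // i /= hi i0; apply: xle; rewrite i0.
have cdiff i j t : (i <= n)%N -> (j <= n)%N -> piece X n x i t -> piece X n x j t ->
    compact_op (fun v => p i t v - p j t v).
  move=> i_n j_n it jt.
  have [_ /C0KP[/(_ t it) ci _ _ _]] := hp i i_n.
  have [_ /C0KP[/(_ t jt) cj _ _ _]] := hp j j_n.
  have := compact_op_add ci (compact_op_scale (-1) cj).
  by congr compact_op; apply/funext => v; vec.
split.
  split.
  - move=> i i_n; have [pi ci] := hp i i_n; apply: projection_lift_CbB pi ci.
    exact: strong_continuous_subset (@piece_sub _ _ _ _) sf.
  - move=> i hi; have /andP[_ i_n] := hi.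
    apply: cdiff; [exact: i_n|exact: leq_trans (leq_pred i) i_n
      |exact: x_left|exact: x_right].
  - move=> XC; have X0 : carrier R X 0 by rewrite XC /= in_itv /= lexx ler01.
    have X1 : carrier R X 1 by rewrite XC /= in_itv /= lexx ler01.
    have [h0 c0] := hp 0%N isT; have [hn cn] := hp n (leqnn n).
    have p0 : piece X n x 0 0.
      split=> // _; have := xX 1%N; rewrite n0 => /(_ isT).
      by rewrite XC /= in_itv /= => /andP[].
    have pn : piece X n x n 1.
      split=> //; last by rewrite ltnn.
      move=> _; have := xX n; rewrite n0 leqnn => /(_ isT).
      by rewrite XC /= in_itv /= => /andP[].
    have /C0KP[/(_ 0 p0) k0 _ _ _] := c0; have /C0KP[/(_ 1 pn) k1 _ _ _] := cn.
    have -> : p 0%N 0 - p n 1 =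
        (fun v => (p 0%N 0 v - f 0 v) + (-1)%:C *: (p n 1 v - f 1 v)).
      by apply/funext => v; rewrite (mf.2 XC) -[LHS]/(p 0%N 0 v - p n 1 v); vec.
    exact: compact_op_add k0 (compact_op_scale (-1) k1).
rewrite FE; apply/seteqP; split=> g [mg cg]; split=> //.
  move=> i i_n; have [_ ci] := hp i i_n.
  apply: C0K_eq (C0K_sub (C0K_subset (@piece_sub X n x i) cg) ci) => t _.
  by apply/funext => v; rewrite -[RHS]/(g t v - p i t v); vec.
apply: (@C0K_piece X n x) => i i_n; have [_ ci] := hp i i_n.
apply: C0K_eq (C0K_add (cg i i_n) ci) => t _; apply/funext => v.
by rewrite -[(_ - _) t v]/(g t v - p i t v); vec.
Qed.

Lemma lebesgue_number D f (a b : R) :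
  (forall t, a <= t <= b -> exists2 e : R, 0 < e &
     projection_lift (D `&` [set y | `|y - t| <= e]) f) ->
  exists2 h : R, 0 < h & forall t, a <= t <= b ->
     projection_lift (D `&` [set y | `|y - t| <= h]) f.
Proof.
move=> loc.
pose P h t := projection_lift (D `&` [set y | `|y - t| <= h]) f.
have near_P t : `[a, b]%classic t -> \forall t' \near t & h \near (0 : R)^'+, P h t'.
  rewrite /= in_itv => /loc[e e0 he]; have e20 : 0 < e / 2 by rewrite divr_gt0.
  (* For [y] within [e / 2] of [t] and [h < e / 2], the [h]-interval around [y] lies in the
     [e]-interval around [t]. *)
  exists ([set y | `|t - y| < e / 2], [set h | h < e / 2]); first split => /=.
  - by have := nbhsx_ballx t _ e20; rewrite -ball_normE.
  - exact: nbhs_right_lt.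
  - move=> [y h] /= [ty hh]; apply: projection_lift_subset he => z [Dz /= zy].
    split=> //=; rewrite -[z - t](subrKA y) (le_trans (ler_normD _ _)) //.
    by move: ty; rewrite distrC; lra.
have /compact_near_coveringP/(_ _ _ _ _ near_P) hcov := @segment_compact R a b.
have [h [h0 hh]] := filter_ex (filterI (nbhs_right_gt (0 : R)) hcov).
by exists h => // t tab; apply: hh; rewrite /= in_itv.
Qed.

End Partition.

(** * Equally spaced division points on each carrier *)

Section Grid.
Variables (R : realType) (H : hilbertType R) (X : base) (f : R -> H -> H).

Definition lift_partition := exists n (x : nat -> R) (p : nat -> R -> H -> H),
  partition_points X n x /\ forall i, (i <= n)%N ->
    (forall t, piece X n x i t -> projection_op (p i t)) /\
    C0K (piece X n x i) (fun y v => p i y v - f y v).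

(** An inner piece lies within [h] of its left end point [c + i h]. The two outer pieces reach the
    ends of the carrier, possibly infinite, and so have hypotheses of their own. *)
Lemma grid_partition (n : nat) (c h : R) : (0 < n)%N -> 0 < h ->
  (forall i, (0 < i <= n)%N -> interior (carrier R X) (c + i%:R * h)) ->
  projection_lift (carrier R X `&` [set t | t <= c + h]) f ->
  projection_lift (carrier R X `&` [set t | c + n%:R * h <= t]) f ->
  (forall i, (0 < i < n)%N ->
    projection_lift (carrier R X `&` [set t | `|t - (c + i%:R * h)| <= h]) f) ->
  lift_partition.
Proof.
move=> n0 h0 xI left right mid; pose x i := c + i%:R * h.
have xS i : x i.+1 = x i + h by rewrite /x -natr1; ring.
have /choice[p pP] : forall i, exists p, (i <= n)%N ->
    (forall t, piece X n x i t -> projection_op (p t)) /\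
    C0K (piece X n x i) (fun y v => p y v - f y v).
  move=> i; have [i_n|ni] := boolP (i <= n)%N; last by exists (fun _ v => v).
  suff [p pP] : projection_lift (piece X n x i) f by exists p.
  have [i0|i0] := posnP i.
    apply: projection_lift_subset left; rewrite i0 => t [Xt _ /(_ n0)].
    by rewrite /x mul1r.
  have [ni|in'] := leqP n i.
    have -> : i = n by apply/eqP; rewrite eqn_leq i_n ni.
    by apply: projection_lift_subset right => t [Xt /(_ n0)].
  apply: projection_lift_subset (mid i _); last by rewrite i0.
  move=> t [Xt /(_ i0) h1 /(_ in')]; rewrite xS => h2; split=> //=.
  by rewrite -/(x i) ger0_norm; lra.
exists n, x, p; split=> //; split=> // i _; rewrite xS ltrDl //.
Qed.

(** Cutting into [n.+1] parts with [n] positive leaves at least one division point, as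
    [partition_points] demands. *)
Lemma small_step (L h : R) : 0 < L -> 0 < h ->
  exists2 n, (0 < n)%N & 0 < L / n.+1%:R <= h.
Proof.
move=> L0 h0; exists (Num.truncn (L / h)).+1 => //.
rewrite divr_gt0 //= ler_pdivrMr // mulrC -ler_pdivrMr //.
by apply/ltW/(lt_le_trans (truncnS_gt _)); rewrite ler_nat.
Qed.

Hypothesis near_lift : forall t, carrier R X t -> exists2 e : R, 0 < e &
  projection_lift (carrier R X `&` [set y | `|y - t| <= e]) f.

Let lebesgue (a b : R) : (forall t, a <= t <= b -> carrier R X t) ->
  exists2 h : R, 0 < h & forall t, a <= t <= b ->
     projection_lift (carrier R X `&` [set y | `|y - t| <= h]) f.
Proof. by move=> ab; apply: lebesgue_number => t /ab; exact: near_lift. Qed.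

Lemma grid_compact : carrier R X = `[0, 1]%classic -> lift_partition.
Proof.
move=> XE; have [|h0 h00 hP] := @lebesgue 0 1.
  by move=> t t01; rewrite XE /= in_itv.
have [n n0 /andP[h1 hh]] := small_step ltr01 h00; set h := 1 / n.+1%:R in h1 hh.
have nh : n%:R * h = 1 - h.
  have : n.+1%:R * h = 1 by rewrite /h mul1r mulfV // pnatr_eq0.
  by rewrite -natr1 => /eqP; rewrite mulrDl mul1r => /eqP; lra.
have ih i : (i <= n)%N -> i%:R * h <= 1 - h.
  by move=> i_n; rewrite -nh ler_wpM2r ?ler_nat // ltW.
have ih0 i : 0 <= i%:R * h by rewrite mulr_ge0 // ltW.
have sub (t : R) (A : set R) : 0 <= t <= 1 ->
    (forall y, 0 <= y <= 1 -> A y -> `|y - t| <= h) ->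
    projection_lift (carrier R X `&` A) f.
  move=> t01 At; apply: projection_lift_subset (hP t t01) => y [Xy Ay].
  split=> //=; rewrite (le_trans (At y _ Ay)) //.
  by move: Xy; rewrite XE /= in_itv.
apply: (@grid_partition n 0 h) => //.
- move=> i /andP[i0 i_n]; rewrite XE interior_itv add0r /= in_itv /=.
  have := ih i i_n; rewrite mulr_gt0 ?ltr0n //=; lra.
- apply: (sub 0) => [|y /andP[y0 y1] /= yh]; first by rewrite lexx ler01.
  by rewrite subr0 ger0_norm //; lra.
- apply: (sub 1) => [|y /andP[y0 y1] /=]; first by rewrite lexx ler01.
  by rewrite nh => hy; rewrite ler_norml; lra.
- move=> i /andP[_ i_n]; apply: (sub (0 + i%:R * h)) => //.
  by have := ih i (ltnW i_n); have := ih0 i; lra.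
Qed.

Lemma grid_half_line (b : R) : carrier R X = `[0, +oo[%classic -> 0 < b ->
  projection_lift (carrier R X `&` [set t | b <= t]) f -> lift_partition.
Proof.
move=> XE b0 right; have [|h0 h00 hP] := @lebesgue 0 b.
  by move=> t /andP[t0 _]; rewrite XE /= in_itv /= t0.
have [n n0 /andP[h1 hh]] := small_step b0 h00; set h := b / n.+1%:R in h1 hh.
have nh : n.+1%:R * h = b by rewrite /h mulrC divfK // pnatr_eq0.
(* One more point than in the compact case: [b] itself is the last division point, and the final
   piece is the part beyond it. *)
apply: (@grid_partition n.+1 0 h) => //.
- move=> i /andP[i0 _]; rewrite XE interior_itv add0r /= in_itv /=.
  by rewrite mulr_gt0 ?ltr0n.
- have [|p pP] := hP 0; first by rewrite lexx ltW.
  apply: projection_lift_subset (ex_intro _ p pP) => t [Xt /= th]; split=> //=.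
  by move: Xt; rewrite XE /= in_itv /= andbT => t0; rewrite subr0 ger0_norm; lra.
- by rewrite add0r nh.
- move=> i /andP[i0 i_n]; rewrite add0r.
  apply: projection_lift_subset (hP (i%:R * h) _) => [t [Xt /= th]|].
    by split=> //=; exact: le_trans th hh.
  have ih : i%:R * h <= n.+1%:R * h by rewrite ler_wpM2r ?(ltW h1) // ler_nat ltnW.
  by rewrite mulr_ge0 ?(ltW h1) //= -[leRHS]nh.
Qed.

Lemma grid_line (a b : R) : carrier R X = setT -> a < b ->
  projection_lift (carrier R X `&` [set t | t <= a]) f ->
  projection_lift (carrier R X `&` [set t | b <= t]) f -> lift_partition.
Proof.
move=> XE ab left right; have [|h0 h00 hP] := @lebesgue a b.
  by move=> t _; rewrite XE.
have ba : 0 < b - a by rewrite subr_gt0.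
have [n n0 /andP[h1 hh]] := small_step ba h00.
set h := (b - a) / n.+1%:R in h1 hh.
have nh : n.+1%:R * h = b - a by rewrite /h mulrC divfK // pnatr_eq0.
have nh2 : n.+2%:R * h = b - a + h by rewrite -natr1 mulrDl mul1r nh.
(* Starting at [a - h] makes the division point of index 1 equal to [a] and that of index [n.+2]
   equal to [b]. *)
apply: (@grid_partition n.+2 (a - h) h) => //.
- by move=> i _; rewrite XE interiorT.
- by rewrite subrK.
- by rewrite nh2 (_ : a - h + _ = b) //; ring.
- move=> i /andP[i0 i_n].
  apply: projection_lift_subset (hP (a - h + i%:R * h) _) => [t [Xt /= th]|].
    by split=> //=; exact: le_trans th hh.
  have i1 : 1 * h <= i%:R * h by rewrite ler_wpM2r ?ler1n // (ltW h1).
  have i2 : i%:R * h <= n.+1%:R * h by rewrite ler_wpM2r ?(ltW h1) // ler_nat.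
  lra.
Qed.

End Grid.

Theorem theorem3p2 (R : realType) (H : hilbertType R)
    (Hsep : separable H) (Hinf : infinite_dimensional H)
    (X : base) (F : set (R -> H -> H)) (HF : corona_projection X F) :
  exists (n : nat) (x : nat -> R) (f : nat -> R -> H -> H),
    [/\ partition_points X n x,
        represents X n x f F
      & forall i, (i <= n)%N ->
          forall t, piece X n x i t -> projection_op (f i t)].
Proof.
have [f [mf af FE cf]] := selfadjoint_lift HF.
suff [n [x [p [xP pP]]]] : lift_partition X f.
  exists n, x, p; split=> //; first exact: (represents_lift xP mf FE pP).
  by move=> i /pP[].
have [M M0 fM] := CbB_bound mf.1.
have hf t : carrier R X t ->
    [/\ linear (f t), isadj (f t) (f t) & opbound (f t) M].
  by move=> Xt; have [l b] := fM t Xt; split=> //; exact: af.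
have sf := CbB_strong_continuous mf.1.
have loc t (Xt : carrier R X t) := projection_lift_near M0 hf sf cf Xt.
have /C0KP[_ _ pinf ninf] := cf.
have e0 : 0 < 1 / 8 :> R by lra.
(* Obtained for every carrier alike, the condition being vacuous at a finite end. The witness
   [|b| + 1] is past the threshold and positive; with the negative [a] below, this gives the order
   of the two points on the line. *)
have [b [b0 rb]] : exists b, 0 < b /\
    projection_lift (carrier R X `&` [set t | b <= t]) f.
  have [b [_ hb]] := pinf _ e0; exists (`|b| + 1); split.
    by rewrite ltr_wpDl.
  apply: (projection_lift_small M0 hf sf cf) => [t []//|t [Xt /= bt]].
  by apply: hb => //; have := ler_norm b; lra.
have [a [a0 la]] : exists a, a < 0 /\
    projection_lift (carrier R X `&` [set t | t <= a]) f.
  have [a [_ ha]] := ninf _ e0; exists (- (`|a| + 1)); split.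
    by rewrite oppr_lt0 ltr_wpDl.
  apply: (projection_lift_small M0 hf sf cf) => [t []//|t [Xt /= ta]].
  by apply: ha => //; have := ler_norm (- a); rewrite normrN; lra.
have [XE|[XE|XE]] : carrier R X = `[0, 1]%classic \/
    carrier R X = `[0, +oo[%classic \/ carrier R X = setT.
  by case: (X); [left|right; left|right; right|left].
- exact: (grid_compact loc XE).
- exact: (grid_half_line loc XE b0 rb).
- exact: (grid_line loc XE (lt_trans a0 b0) la rb).
Qed.
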